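(* Let $i,j$ be nonnegative integers and let $T$ be a Haar shift on $\mathbb{R}$ of complexity $(i,j)$ with kernel coefficients $a^I_{KL}$. Assume the following non-degeneracy condition: there exists a constant $c>0$ (depending only on $i,j$) such that $$|a^I_{KL}|\geq\frac1{c|I|}$$ for all $I\in\mathcal{D}$, $K\in\mathrm{ch}_{i+1}(I)$ and $L\in\mathrm{ch}_{j+1}(I)$ for which there is no $J\in\mathrm{ch}_1(I)$ with $K\cup L\subseteq J$. Let $1<p<\infty$, let $p'$ be its Hölder conjugate exponent, and let $\mu,\lambda$ be dyadic $A_p$ weights on $\mathbb{R}$. Then for every $J\in\mathcal{D}$, $$\left(\frac1{\mu(J)}\int_J|b(x)-\langle b\rangle_J|^p\lambda(x)\,dx\right)^{1/p}\leq c\,c_p\,2^{\frac{i+1}{p'}}\,\|[T,b]\|_{L^p(\mu)\to L^p(\lambda)},$$ where $c_p>0$ is a constant depending only on $p$.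
   Context: $\mathcal{D}$ denotes the family of all dyadic intervals in $\mathbb{R}$. For $I\in\mathcal{D}$ and an integer $n\geq0$, $\mathrm{ch}_n(I)$ is the set of dyadic subintervals of $I$ of length $2^{-n}|I|$. With $I_-,I_+$ the left and right halves of $I$, $h_I=(\mathbf{1}_{I_+}-\mathbf{1}_{I_-})/\sqrt{|I|}$ is the Haar function and $f_I=(f,h_I)$. A Haar shift of complexity $(i,j)$ is an operator of the form $$Tf=\sum_{I\in\mathcal{D}}\ \sum_{K\in\mathrm{ch}_i(I),\,L\in\mathrm{ch}_j(I)}c^I_{KL}\,f_K\,h_L,$$ where the $c^I_{KL}$ are complex numbers with $|c^I_{KL}|\leq2^{-(i+j)/2}$. Its (formal) kernel is $$\mathcal{K}(x,y)=\sum_{I\in\mathcal{D}}\ \sum_{K\in\mathrm{ch}_i(I),\,L\in\mathrm{ch}_j(I)}c^I_{KL}\,h_K(y)\,h_L(x),\qquad x\neq y,$$ where the sum converges absolutely. One can write $\mathcal{K}(x,y)=\sum_{I\in\mathcal{D}}\sum_{K\in\mathrm{ch}_{i+1}(I),\,L\in\mathrm{ch}_{j+1}(I)}a^I_{KL}\mathbf{1}_K(y)\mathbf{1}_L(x)$ for $x\neq y$, where $a^I_{KL}=0$ whenever some $J\in\mathrm{ch}_1(I)$ contains $K\cup L$; otherwise $a^I_{KL}$ is the (constant) value of $\mathcal{K}(x,y)$ for $x\in L$, $y\in K$ (in that case $I$ is the minimal dyadic interval containing both $x$ and $y$). A weight on $\mathbb{R}$ is a locally integrable function that is positive almost everywhere;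 $w$ is a dyadic $A_p$ weight if $\sup_{I\in\mathcal{D}}\big(\frac1{|I|}\int_Iw\big)\big(\frac1{|I|}\int_Iw^{-1/(p-1)}\big)^{p-1}<\infty$. Write $\|f\|_{L^p(w)}^p=\int|f|^pw\,dx$, $w(J)=\int_Jw\,dx$ and $\langle b\rangle_J=\frac1{|J|}\int_Jb\,dx$. Here $b$ is a locally integrable function on $\mathbb{R}$ and $[T,b]f=T(bf)-b\,Tf$, understood on bounded compactly supported $f$ (with $T$ extended to integrable functions as an operator of weak type $(1,1)$); $\|[T,b]\|_{L^p(\mu)\to L^p(\lambda)}$ is the operator norm, equal to $+\infty$ if $[T,b]$ is not bounded. *)

(* Defs.v *)
(* Complex scalars are [R[i]] from real-closed. *)
From HB Require Import structures.
From mathcomp Require Import all_boot all_order all_algebra.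
From mathcomp Require Import finmap complex.
From mathcomp Require Import all_classical all_reals all_analysis.
From mathcomp.analysis.showcase Require Import summability.

Set Implicit Arguments.
Unset Strict Implicit.
Unset Printing Implicit Defensive.

Import Order.TTheory GRing.Theory Num.Theory.
Import numFieldNormedType.Exports.
Export ComplexField.Normc.

Local Open Scope classical_set_scope.
Local Open Scope complex_scope.
Local Open Scope ring_scope.

Local Notation Re := complex.Re.
Local Notation Im := complex.Im.

(* The pair (k, m) stands for the dyadic interval [m 2^-k, (m+1) 2^-k[;
   this is a bijection between int * int and the family of dyadic intervals. *)
Definition dyadic : Type := (int * int)%type.

Section Dyadic.
Context {R : realType}.
Implicit Types (I J K L : dyadic) (x y : R).

Definition dlen I : R := 2 ^ (- I.1).
Definition dleft I : R := I.2%:~R * dlen I.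
Definition dset I : set R := `[dleft I, dleft I + dlen I[.

Definition lhalf I : dyadic := (I.1 + 1, 2 * I.2).
Definition rhalf I : dyadic := (I.1 + 1, 2 * I.2 + 1).

Definition haar I x : R :=
  (\1_(dset (rhalf I)) x - \1_(dset (lhalf I)) x) / Num.sqrt (dlen I).

End Dyadic.

Definition ch (R : realType) (n : nat) (I : dyadic) : set dyadic :=
  [set K | @dset R K `<=` dset I /\ @dlen R K = 2 ^- n * dlen I].

(* Complex-valued functions are handled through their real and imaginary
   parts; [normc : R[i] -> R] is the modulus. *)
Section ComplexValued.
Context {R : realType}.
Local Notation leb := (@lebesgue_measure R).
Implicit Types (f b : R -> R[i]) (w : R -> R) (D : set R).

Definition cmeasurable f : Prop :=
  measurable_fun setT (fun x => Re (f x)) /\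
  measurable_fun setT (fun x => Im (f x)).

Definition cintegrable f : Prop :=
  leb.-integrable setT (fun x => (Re (f x))%:E) /\
  leb.-integrable setT (fun x => (Im (f x))%:E).

Definition clocally_integrable f : Prop :=
  locally_integrable setT (fun x => Re (f x)) /\
  locally_integrable setT (fun x => Im (f x)).

Definition cintegral D f : R[i] :=
  (\int[leb]_(x in D) Re (f x)) +i* (\int[leb]_(x in D) Im (f x)).

(* Unconditional sum: limit along the finite subsets of dyadic intervals. *)
Definition csum (u : dyadic -> R[i]) : R[i] :=
  sum (fun I => Re (u I)) +i* sum (fun I => Im (u I)).

Definition cmean f (J : dyadic) : R[i] :=
  ((dlen J)^-1)%:C * cintegral (dset J) f.

Definition wLpnorm (p : R) w f : \bar R :=
  ((\int[leb]_x (normc (f x) `^ p * w x)%:E) `^ p^-1)%E.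

Definition L2norm f : \bar R := wLpnorm 2 (cst 1) f.

Definition inL2 f : Prop := cmeasurable f /\ (L2norm f < +oo)%E.

Definition bounded_compactly_supported f : Prop :=
  [/\ cmeasurable f, exists M : R, forall x, normc (f x) <= M &
      exists A : set R, compact A /\ forall x, ~ A x -> f x = 0].

Definition is_weight w : Prop :=
  locally_integrable setT w /\ {ae leb, forall x, 0 < w x}.

Definition wmass w (J : dyadic) : \bar R :=
  (\int[leb]_(x in dset J) (w x)%:E)%E.

Definition wmean w (J : dyadic) : \bar R := (((dlen J)^-1)%:E * wmass w J)%E.

Definition dyadic_Ap (p : R) w : Prop :=
  is_weight w /\
  (ereal_sup
     [set wmean w I * wmean (fun x => w x `^ (- (p - 1)^-1))%R I `^ (p - 1)%R
     | I in [set: dyadic]] < +oo)%E.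

End ComplexValued.

Section HaarShift.
Context {R : realType}.
Local Notation leb := (@lebesgue_measure R).
Implicit Types (c : dyadic -> dyadic -> dyadic -> R[i])
  (T : (R -> R[i]) -> (R -> R[i])) (f b : R -> R[i]) (I J K L : dyadic).

Definition haar_coef f I : R[i] :=
  cintegral setT (fun x => f x * (haar I x)%:C).

Definition haar_shift_term i j c I f (x : R) : R[i] :=
  \sum_(K \in ch R i I) \sum_(L \in ch R j I)
    c I K L * haar_coef f K * (haar L x)%:C.

(* [T] is determined almost everywhere on L^2 + L^1 by these clauses:
   on L^2 the defining series converges to [T f] unconditionally in L^2, and
   on L^1 [T] is the linear extension satisfying a weak type (1,1) bound.
   Nothing is required of [T f] for other [f]. *)
Record is_haar_shift (i j : nat) c T : Prop := IsHaarShift {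
  haar_shift_bound : forall I K L, ch R i I K -> ch R j I L ->
    normc (c I K L) <= 2 `^ (- ((i + j)%:R / 2));
  haar_shift_L2_measurable : forall f, inL2 f -> cmeasurable (T f);
  haar_shift_L2_series : forall f, inL2 f ->
    (fun F : {fset dyadic} =>
       L2norm (fun x => T f x - \sum_(I <- F) haar_shift_term i j c I f x))
      @ totally --> (0 : \bar R);
  haar_shift_L1_measurable : forall f, cintegrable f -> cmeasurable (T f);
  haar_shift_L1_linear : forall (z : R[i]) f g,
    cintegrable f -> cintegrable g ->
    {ae leb, forall x, T (fun y => z * f y + g y) x = z * T f x + T g x};
  haar_shift_weak11 : exists C : R, forall f, cintegrable f ->
    forall t : R, 0 < t ->
      (leb [set x | (t < normc (T f x))%R]
         <= (C / t)%:E * \int[leb]_x (normc (f x))%:E)%E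
}.

Definition haar_kernel i j c (x y : R) : R[i] :=
  csum (fun I => \sum_(K \in ch R i I) \sum_(L \in ch R j I)
    c I K L * (haar K y)%:C * (haar L x)%:C).

Definition in_common_half I K L : Prop :=
  exists J, ch R 1 I J /\ @dset R K `|` dset L `<=` dset J.

(* When [K] and [L] are not in a common half of [I], the kernel is constant
   on L x K; its value is read off at the left endpoints. *)
Definition kernel_coef i j c I K L : R[i] :=
  if `[< in_common_half I K L >] then 0
  else haar_kernel i j c (dleft L) (dleft K).

Definition nondegenerate_kernel i j c (c0 : R) : Prop :=
  forall I K L, ch R i.+1 I K -> ch R j.+1 I L -> ~ in_common_half I K L ->
    1 / (c0 * dlen I) <= normc (kernel_coef i j c I K L).

Definition mult_commutator T b f (x : R) : R[i] :=
  T (fun y => b y * f y) x - b x * T f x.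

(* The infimum of the empty set is +oo. *)
Definition commutator_norm (p : R) (mu lambda : R -> R) T b : \bar R :=
  ereal_inf [set M%:E | M in [set M : R | 0 <= M /\
    forall f, bounded_compactly_supported f ->
      (wLpnorm p lambda (mult_commutator T b f) <= M%:E * wLpnorm p mu f)%E]].

End HaarShift.

(* Main.v *)
(** Fix the halves [P], [Q] of a dyadic interval [I] and [K] in ch_i(P).  On [Q]
    the commutator applied to 1_K equals a^I_{KL} |K| (<b>_K - b), so the
    non-degeneracy bounds int_Q |b - <b>_K|^p lambda by
    (2^(i+1) c N)^p mu(K), where N is the norm of the commutator.  Averaging over
    the 2^i intervals [K] (convexity of t^p) gives
      int_Q |b - <b>_P|^p lambda <= 2^(-i) (2^(i+1) c N)^p mu(P).
    No A_p constant is lost in passing to <b>_J: for x in [J], b(x) - <b>_J is the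
    average, with weights 2^(-k-1), of b(x) - <b>_{S_k(x)}, where S_k(x) is the
    sibling of the dyadic interval of length 2^(-k-1) |J| containing [x].  By
    convexity and monotone convergence int_J |b - <b>_J|^p lambda is bounded by the
    averaged estimates above, whose k-th level sums to a multiple of mu(J). *)

Require Import Defs.
From HB Require Import structures.
From mathcomp Require Import all_boot all_order all_algebra.
From mathcomp Require Import finmap complex ring lra zify.
From mathcomp Require Import all_classical all_reals all_analysis measurable_realfun.
From mathcomp.analysis.showcase Require Import summability.

Set Implicit Arguments.
Unset Strict Implicit.
Unset Printing Implicit Defensive.

Import Order.TTheory GRing.Theory Num.Theory.
Import numFieldNormedType.Exports.

Local Open Scope classical_set_scope.
Local Open Scope complex_scope.
Local Open Scope ring_scope.

Local Notation Re := complex.Re.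
Local Notation Im := complex.Im.

(** * Dyadic intervals *)

(** The operator [T] is known only through a series converging in L^2 and, on L^1, through linearity
    and a weak type bound. But b 1_K is merely integrable, and [haar_kernel] is defined as a limit
    whose existence is not part of the data. The commutator formula on Q therefore has to be
    derived. For f supported in K, every term of the Haar series is constant on L in ch_j(Q): it is
    the integral of f times the corresponding term of the kernel sum. With f = 1_K, convergence in
    L^2 forces the kernel sum to converge; with f bounded, it identifies T f on L. Truncation and
    the weak type bound then reach integrable f.

    The constant is c_p = 2^(1/p), because (2^(-i) (2^(i+1) c N)^p)^(1/p) = 2^(1/p) 2^((i+1)/p') c
    N. Passing to the siblings costs nothing more: those of a given level partition J, so their
    masses add up to mu(J), and the weights 2^(-k-1) have sum 1. *)

Definition is_split (I P Q : dyadic) : Prop :=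
  (P = lhalf I /\ Q = rhalf I) \/ (P = rhalf I /\ Q = lhalf I).

(** A list form of ch_n(I), built by halving from the top, so that induction on n follows the
    identity that a mean over I is the midpoint of the means over its halves. *)
Fixpoint descendants (n : nat) (I : dyadic) : seq dyadic :=
  if n is n'.+1 then descendants n' (lhalf I) ++ descendants n' (rhalf I)
  else [:: I].

Section DyadicFacts.
Context {R : realType}.
Implicit Types (I J K L P Q : dyadic) (x y : R).
Local Notation dset := (@dset R).
Local Notation dlen := (@dlen R).

Lemma dlen_gt0 I : 0 < dlen I.
Proof. by rewrite /Defs.dlen exprz_gt0. Qed.

Lemma dlen_level I J : I.1 = J.1 -> dlen I = dlen J.
Proof. by rewrite /Defs.dlen => ->. Qed.

Lemma dlen_succ I J : J.1 = I.1 + 1 -> dlen J = dlen I / 2.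
Proof. by move=> e; rewrite /Defs.dlen e opprD expfzDr// exprN1. Qed.

Lemma dlenD (n : nat) I J : J.1 = I.1 + n%:Z -> dlen I = 2 ^+ n * dlen J.
Proof.
move=> e; rewrite /Defs.dlen e opprD expfzDr// mulrCA -[2 ^+ n]/(2 ^ n%:Z).
by rewrite -expfzDr// subrr expr0z mulr1.
Qed.

Lemma dsetE I x : dset I x <-> dleft I <= x < dleft I + dlen I.
Proof. by rewrite /Defs.dset /= in_itv. Qed.

Lemma dleft_dset I : dset I (dleft I).
Proof. by apply/dsetE; rewrite lexx ltrDl dlen_gt0. Qed.

Lemma dset_nested I J x : I.1 <= J.1 -> dset I x -> dset J x ->
  dset J `<=` dset I.
Proof.
move=> IJ; have [n en] : exists n : nat, J.1 = I.1 + n%:Z.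
  by exists `|J.1 - I.1|%N; rewrite gez0_abs ?subr_ge0// subrKC.
have e := dlenD en; have J0 := dlen_gt0 J.
move=> /dsetE + /dsetE + y /dsetE + ; rewrite dsetE /dleft e.
rewrite -[X in _ < X + dlen J]mulr1z.
(* In units of the shorter length [d] all endpoints are integers. The common point gives a 2^n < m +
   1 and m < (a + 1) 2^n, and integrality sharpens both to the inclusion. *)
set a := I.2; set m := J.2; set d := dlen J in J0 *.
have -> : a%:~R * (2 ^+ n * d) = (a * 2 ^+ n)%:~R * d.
  by rewrite intrM rmorphXn/= mulrA.
have -> : (a * 2 ^+ n)%:~R * d + 2 ^+ n * d = (a * 2 ^+ n + 2 ^+ n)%:~R * d.
  by rewrite -mulrDl intrD rmorphXn.
have -> : m%:~R * d *~ 1 + d = (m + 1)%:~R * d by rewrite mulr1z intrD mulrDl mul1r.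
move=> /andP[h1 h2] /andP[h3 h4] /andP[h5 h6].
have := le_lt_trans h1 h4; rewrite ltr_pM2r// ltr_int ltzD1 => am.
have := le_lt_trans h3 h2; rewrite ltr_pM2r// ltr_int -lezD1 => ma.
apply/andP; split; first by rewrite (le_trans _ h5)// ler_pM2r// ler_int.
by rewrite (lt_le_trans h6)// ler_pM2r// ler_int.
Qed.

Lemma dset_halves I x : dset I x <-> dset (lhalf I) x \/ dset (rhalf I) x.
Proof.
have d0 := dlen_gt0 I.
rewrite !dsetE /dleft !(@dlen_succ I (lhalf I))// !(@dlen_succ I (rhalf I))//=.
rewrite intrD !intrM.
have -> : 2%:~R * I.2%:~R * (dlen I / 2) = I.2%:~R * dlen I by field.
have -> : (2%:~R * I.2%:~R + 1%:~R) * (dlen I / 2) = I.2%:~R * dlen I + dlen I / 2.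
  by field.
split; last by case=> /andP[? ?]; apply/andP; split; lra.
move=> /andP[h1 h2].
have [h|h] := ltP x (I.2%:~R * dlen I + dlen I / 2); [left|right];
 by apply/andP; split; lra.
Qed.

Lemma lhalf_rhalf_disj I x : dset (lhalf I) x -> ~ dset (rhalf I) x.
Proof.
have d0 := dlen_gt0 I.
rewrite !dsetE /dleft !(@dlen_succ I (lhalf I))// !(@dlen_succ I (rhalf I))//=.
rewrite intrD !intrM.
have -> : 2%:~R * I.2%:~R * (dlen I / 2) = I.2%:~R * dlen I by field.
have -> : (2%:~R * I.2%:~R + 1%:~R) * (dlen I / 2) = I.2%:~R * dlen I + dlen I / 2.
  by field.
move=> /andP[h1 h2] /andP[h3 h4]; lra.
Qed.

Lemma is_split_sym I P Q : is_split I P Q -> is_split I Q P.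
Proof. by case=> -[-> ->]; [right|left]. Qed.

Lemma is_split_halves I P Q x : is_split I P Q ->
  dset I x <-> dset P x \/ dset Q x.
Proof. by move=> [] [-> ->]; rewrite dset_halves// or_comm. Qed.

Lemma is_split_level I P Q : is_split I P Q -> P.1 = I.1 + 1.
Proof. by case=> -[-> _]. Qed.

Lemma is_split_disj I P Q x : is_split I P Q -> dset P x -> ~ dset Q x.
Proof.
by case=> -[-> ->]; [exact: lhalf_rhalf_disj | move=> r l; exact: lhalf_rhalf_disj r].
Qed.

Lemma is_split_sub I P Q : is_split I P Q -> dset P `<=` dset I.
Proof. by move=> s x Px; apply/(is_split_halves _ s); left. Qed.

Lemma lhalf_split I : is_split I (lhalf I) (rhalf I). Proof. by left. Qed.
Lemma rhalf_split I : is_split I (rhalf I) (lhalf I). Proof. by right. Qed.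

Lemma dset_inj_level I J : I.1 = J.1 -> dset I `<=` dset J -> I = J.
Proof.
move=> e IJ; have /dsetE/andP[h1 h2] := IJ _ (dleft_dset I).
have J0 := dlen_gt0 J; move: h1 h2; rewrite /dleft (dlen_level e).
rewrite ler_pM2r// ler_int => h1.
rewrite -[X in _ < _ + X]mul1r -mulrDl ltr_pM2r//.
rewrite -[X in _ + X]/(1%:~R) -intrD ltr_int ltzD1 => h2.
case: I J e IJ h1 h2 J0 => ? ? [? ?] /= -> _ h1 h2 _.
by congr pair; apply/eqP; rewrite eq_le h2.
Qed.

Lemma dlen_ratio (n : nat) I J : dlen J = 2 ^- n * dlen I -> J.1 = I.1 + n%:Z.
Proof.
rewrite /Defs.dlen => e.
have : (2 : R) ^ (- J.1) = 2 ^ (- (I.1 + n%:Z)).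
  by rewrite e opprD expfzDr// mulrC -(invr_expz _ n).
by move/ieexprIz => /(_ ltac:(lra))/(_ ltac:(apply/eqP; lra))/oppr_inj.
Qed.

Lemma chP n I K : ch R n I K -> dset K `<=` dset I /\ K.1 = I.1 + n%:Z.
Proof. by move=> [? /dlen_ratio]. Qed.

Lemma ch_level n I K : dset K `<=` dset I -> K.1 = I.1 + n%:Z -> ch R n I K.
Proof. by move=> KI e; split=> //; rewrite (dlenD e) mulKf. Qed.

Lemma descendants_ch n I K : K \in descendants n I -> ch R n I K.
Proof.
elim: n I => [|n IH] I /=.
  by rewrite inE => /eqP ->; apply: ch_level; rewrite ?addr0.
rewrite mem_cat => /orP[] /IH/chP[KI e]; (apply: ch_level;
  [move=> x /KI h; apply/dset_halves; tauto
  |by rewrite e/= -addrA -PoszD add1n]).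
Qed.

Lemma dset_sub_half I K x : I.1 < K.1 -> dset I x -> dset K x ->
  dset K `<=` dset (lhalf I) \/ dset K `<=` dset (rhalf I).
Proof.
move=> IK /dset_halves[] hx Kx; [left|right];
  by apply: dset_nested hx Kx; rewrite /= lezD1.
Qed.

Lemma ch_descendants n I K : ch R n I K -> K \in descendants n I.
Proof.
elim: n I => [|n IH] I /chP[KI e].
  by rewrite inE; apply/eqP/dset_inj_level; rewrite // e addr0.
rewrite /= mem_cat.
have [||h|h] := @dset_sub_half I K (dleft K) _ (KI _ (dleft_dset K)).
- by rewrite e; lia.
- exact: dleft_dset.
- by rewrite (IH (lhalf I))//; apply: ch_level => //=; rewrite e; lia.
- by rewrite orbC (IH (rhalf I))//; apply: ch_level => //=; rewrite e; lia.
Qed.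

Lemma ch_finite n I : finite_set (ch R n I).
Proof.
apply: (@sub_finite_set _ _ [set` descendants n I]) => [K|].
  exact: ch_descendants.
exact: finite_seq.
Qed.

Lemma descendants_cover n I x : dset I x ->
  exists2 K, K \in descendants n I & dset K x.
Proof.
elim: n I => [|n IH] I Ix; first by exists I => //=; rewrite inE.
by move: Ix => /dset_halves[] /IH[K Kn Kx]; exists K => //=;
  rewrite mem_cat Kn ?orbT.
Qed.

(** A common half would have the level of P and meet P, hence lie in P; yet it would contain a point
    of L, which is in Q. *)
Lemma not_common_half I P Q K L : is_split I P Q ->
  dset K `<=` dset P -> dset L `<=` dset Q -> ~ @in_common_half R I K L.
Proof.
move=> s KP LQ [J [/chP[_ eJ] KL]].
have eP := is_split_level s.
have JK : dset J (dleft K) by apply: KL; left; exact: dleft_dset.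
have JP : dset J `<=` dset P.
  by apply: dset_nested (KP _ (dleft_dset K)) JK; rewrite eP eJ.
have := JP (dleft L) (KL _ (or_intror (dleft_dset L))).
by move=> /(is_split_disj s); apply; apply: LQ; exact: dleft_dset.
Qed.

(** The halves of K' are still at least as long as K, so each of them contains K or misses it. *)
Lemma haar_const K K' x : K'.1 < K.1 -> dset K x ->
  haar K' x = haar K' (dleft K).
Proof.
move=> lt Kx; rewrite /haar.
have h H : H.1 = K'.1 + 1 -> \1_(dset H) x = \1_(dset H) (dleft K) :> R.
  move=> eH; have le : H.1 <= K.1 by rewrite eH lezD1.
  rewrite !indicE; congr ((nat_of_bool _)%:R); apply/idP/idP; rewrite !inE => hx.
    by apply: (dset_nested le hx Kx); exact: dleft_dset.
  by apply: (dset_nested le hx (dleft_dset K)).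
by rewrite !h.
Qed.

Lemma haar_out K x : ~ dset K x -> haar K x = 0.
Proof.
move=> nK; rewrite /haar !indicE !memNset ?subr0 ?mul0r//.
  by move=> h; apply: nK; apply/dset_halves; left.
by move=> h; apply: nK; apply/dset_halves; right.
Qed.

End DyadicFacts.

(** * Complex-valued functions *)

Lemma measurable_dset (R : realType) (I : dyadic) : measurable (@dset R I).
Proof. exact: measurable_itv. Qed.
#[local] Hint Extern 0 (measurable (dset _)) => solve[exact: measurable_dset] : core.

Section ComplexFacts.
Context {R : realType}.
Local Notation leb := (@lebesgue_measure R).
Implicit Types (z w : R[i]) (f g b : R -> R[i]) (I J K L P Q : dyadic) (D : set R).

Lemma normcE z : normc z = Num.sqrt (Re z ^+ 2 + Im z ^+ 2).
Proof. by case: z. Qed.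

Lemma normc_ge0 z : 0 <= normc z.
Proof. by rewrite normcE sqrtr_ge0. Qed.

Lemma normcD z w : normc (z + w) <= normc z + normc w.
Proof. exact: (@le_normcD R z w). Qed.

Lemma normc_opp z : normc (- z) = normc z.
Proof. exact: (@normcN R z). Qed.

Lemma normcB z w : normc (z - w) = normc (w - z).
Proof. by rewrite -normc_opp opprB. Qed.

Lemma normc_real (r : R) : normc r%:C = `|r|.
Proof. by rewrite /= expr0n /= addr0 sqrtr_sqr. Qed.

Lemma sqr_normcE z : normc z ^+ 2 = Re z ^+ 2 + Im z ^+ 2.
Proof. by rewrite normcE sqr_sqrtr// addr_ge0 ?sqr_ge0. Qed.

Lemma normRe_le z : `|Re z| <= normc z.
Proof. by rewrite normcE -sqrtr_sqr ler_sqrt ?lerDl ?addr_ge0 ?sqr_ge0. Qed.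

Lemma normIm_le z : `|Im z| <= normc z.
Proof. by rewrite normcE -sqrtr_sqr ler_sqrt ?lerDr ?addr_ge0 ?sqr_ge0. Qed.

Lemma normc_le_ReIm z : normc z <= `|Re z| + `|Im z|.
Proof.
rewrite -(@ler_pXn2r _ 2) ?nnegrE ?normc_ge0 ?addr_ge0//.
rewrite sqr_normcE sqrrD !real_normK ?num_real//.
by rewrite addrAC lerDl mulrn_wge0// mulr_ge0.
Qed.

Lemma Re_add z w : Re (z + w) = Re z + Re w. Proof. by case: z; case: w. Qed.
Lemma Im_add z w : Im (z + w) = Im z + Im w. Proof. by case: z; case: w. Qed.
Lemma Re_opp z : Re (- z) = - Re z. Proof. by case: z. Qed.
Lemma Im_opp z : Im (- z) = - Im z. Proof. by case: z. Qed.
Lemma Re_mul z w : Re (z * w) = Re z * Re w - Im z * Im w.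
Proof. by case: z; case: w. Qed.
Lemma Im_mul z w : Im (z * w) = Re z * Im w + Im z * Re w.
Proof. by case: z; case: w. Qed.

Lemma eqc z w : Re z = Re w -> Im z = Im w -> z = w.
Proof. by case: z; case: w => ? ? ? ? /= -> ->. Qed.

Lemma complex_midpointB (a z w : R[i]) :
  a - (2^-1)%:C * (z + w) = (2^-1)%:C * ((a - z) + (a - w)).
Proof. by case: a z w => [? ?] [? ?] [? ?]; apply: eqc => /=; field. Qed.

Lemma Re_sum (T : Type) (s : seq T) (F : T -> R[i]) :
  Re (\sum_(i <- s) F i) = \sum_(i <- s) Re (F i).
Proof. exact: (big_morph (@complex.Re R) Re_add erefl). Qed.

Lemma Im_sum (T : Type) (s : seq T) (F : T -> R[i]) :
  Im (\sum_(i <- s) F i) = \sum_(i <- s) Im (F i).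
Proof. exact: (big_morph (@complex.Im R) Im_add erefl). Qed.

Lemma cmeasurable_cst z : cmeasurable (fun=> z : R[i]).
Proof. by split; exact: measurable_cst. Qed.

Lemma cmeasurable_real (h : R -> R) :
  measurable_fun setT h -> cmeasurable (fun x => (h x)%:C).
Proof. by move=> mh; split => //; exact: measurable_cst. Qed.

Lemma cmeasurableD f g : cmeasurable f -> cmeasurable g ->
  cmeasurable (fun x => f x + g x).
Proof.
move=> [mf1 mf2] [mg1 mg2]; split.
  by under eq_fun do rewrite Re_add; exact: measurable_funD.
by under eq_fun do rewrite Im_add; exact: measurable_funD.
Qed.

Lemma cmeasurableN f : cmeasurable f -> cmeasurable (fun x => - f x).
Proof.
move=> [mf1 mf2]; split.
  by under eq_fun do rewrite Re_opp; exact: measurableT_comp.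
by under eq_fun do rewrite Im_opp; exact: measurableT_comp.
Qed.

Lemma cmeasurableB f g : cmeasurable f -> cmeasurable g ->
  cmeasurable (fun x => f x - g x).
Proof. by move=> mf mg; exact/cmeasurableD/cmeasurableN. Qed.

Lemma cmeasurableM f g : cmeasurable f -> cmeasurable g ->
  cmeasurable (fun x => f x * g x).
Proof.
move=> [mf1 mf2] [mg1 mg2]; split.
  under eq_fun do rewrite Re_mul.
  by apply: measurable_funB; exact: measurable_funM.
under eq_fun do rewrite Im_mul.
by apply: measurable_funD; exact: measurable_funM.
Qed.

Lemma cmeasurable_sum (T : Type) (s : seq T) (F : T -> R -> R[i]) :
  (forall i, cmeasurable (F i)) -> cmeasurable (fun x => \sum_(i <- s) F i x).
Proof.
move=> mF; elim: s => [|i s IH].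
  by under eq_fun do rewrite big_nil; exact: cmeasurable_cst.
by under eq_fun do rewrite big_cons; exact: cmeasurableD.
Qed.

Lemma measurable_normc f : cmeasurable f ->
  measurable_fun setT (fun x => normc (f x)).
Proof.
move=> [mf1 mf2]; under eq_fun do rewrite normcE.
apply: (@measurableT_comp _ _ _ _ _ _ (@Num.sqrt R)).
  apply: continuous_measurable_fun; exact: sqrt_continuous.
by apply: measurable_funD; exact: measurable_funX.
Qed.

Lemma measurable_normc_powR f (p : R) : cmeasurable f ->
  measurable_fun setT (fun x => normc (f x) `^ p).
Proof.
move=> mf; apply: (@measurableT_comp _ _ _ _ _ _ (@powR R ^~ p)).
  exact: measurable_powR.
exact: measurable_normc.
Qed.

Lemma lebesgue_dset I : leb (dset I) = (dlen I)%:E.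
Proof.
rewrite /dset lebesgue_measure_itv/= lte_fin ltrDl dlen_gt0.
by rewrite -EFinD addrAC subrr add0r.
Qed.

(** Local integrability speaks of compact sets, and a dyadic interval is half-open; its closure
    serves instead. *)
Lemma integrable_dset (h : R -> R) I : locally_integrable setT h ->
  leb.-integrable (dset I) (EFin \o h).
Proof.
move=> [mh _ hfin]; set l : R := dleft I; set u := l + dlen I.
apply: (@integrableS _ _ _ leb `[l, u]) => //.
  by move=> x /dsetE /andP[h1 /ltW h2]; rewrite /= in_itv/= h1.
apply/integrableP; split; last by apply: hfin => //; exact: segment_compact.
by apply/measurable_EFinP; exact: measurable_funTS.
Qed.

Lemma dset_splitE I P Q : is_split I P Q -> @dset R I = dset P `|` dset Q.
Proof. by move=> s; apply/seteqP; split=> x /(is_split_halves _ s). Qed.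

Lemma dset_split_disj I P Q : is_split I P Q -> [disjoint @dset R P & dset Q].
Proof.
move=> s; apply/disj_setPS => x [Px Qx]; exact: is_split_disj s Px Qx.
Qed.

Lemma ge0_integral_split I P Q (h : R -> \bar R) : is_split I P Q ->
  measurable_fun setT h -> (forall x, (0 <= h x)%E) ->
  (\int[leb]_(x in dset I) h x =
   \int[leb]_(x in dset P) h x + \int[leb]_(x in dset Q) h x)%E.
Proof.
move=> s mh h0; rewrite (dset_splitE s) ge0_integral_setU//.
  exact: measurable_funTS.
exact: dset_split_disj s.
Qed.

Lemma Rintegral_split I P Q (h : R -> R) : is_split I P Q ->
  locally_integrable setT h ->
  \int[leb]_(x in dset I) h x =
   \int[leb]_(x in dset P) h x + \int[leb]_(x in dset Q) h x.
Proof.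
move=> s lh; rewrite (dset_splitE s) Rintegral_setU//.
  by rewrite -(dset_splitE s); exact: integrable_dset.
exact: dset_split_disj s.
Qed.

Lemma cintegral_split I P Q b : is_split I P Q -> clocally_integrable b ->
  cintegral (dset I) b = cintegral (dset P) b + cintegral (dset Q) b.
Proof.
move=> s [lr li]; rewrite /cintegral (Rintegral_split s lr).
by rewrite (Rintegral_split s li).
Qed.

Lemma cmean_split I P Q b : is_split I P Q -> clocally_integrable b ->
  cmean b I = (2^-1)%:C * (cmean b P + cmean b Q).
Proof.
move=> s lb; rewrite /cmean (cintegral_split s lb).
rewrite (dlen_succ (is_split_level s)).
rewrite (dlen_succ (is_split_level (is_split_sym s))).
rewrite -mulrDr mulrA -rmorphM/=; congr (_%:C * _).
by have /lt0r_neq0 := @dlen_gt0 R I; move=> ?; field.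
Qed.

Lemma clocally_integrable_cmeasurable b : clocally_integrable b -> cmeasurable b.
Proof. by move=> [[? _ _] [? _ _]]. Qed.

End ComplexFacts.

(** * Siblings and mean oscillation *)

Section Oscillation.
Context {R : realType}.
Local Notation leb := (@lebesgue_measure R).
Implicit Types (b : R -> R[i]) (I J K L P Q : dyadic) (u : dyadic -> R -> R).

Lemma powR_midpoint (p x y : R) : 1 <= p -> 0 <= x -> 0 <= y ->
  ((x + y) / 2) `^ p <= (x `^ p + y `^ p) / 2.
Proof.
move=> p1 x0 y0.
have h0 : 0 <= 2^-1 :> R by lra.
have h1 : 2^-1 <= 1 :> R by lra.
have := @convex_powR R p p1 (Itv01 h0 h1) x y.
rewrite !inE /= !in_itv/= !andbT => /(_ x0 y0).
rewrite convRE [X in X `^ _ <= _ -> _]convRE /= /unstable.onem.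
rewrite (_ : 1 - 2^-1 = 2^-1 :> R); last by field.
have -> : (x + y) / 2 = 2^-1 * x + 2^-1 * y by field.
have -> : (x `^ p + y `^ p) / 2 = 2^-1 * x `^ p + 2^-1 * y `^ p by field.
by [].
Qed.

(* Up to the part of [I] within the n-th dyadic interval around [x], [I] is the
   union of the siblings of the smaller dyadic intervals around [x]; the k-th
   sibling carries the fraction 2^-k of [I]. *)
Fixpoint sibling_sum u (n : nat) I (x : R) : R :=
  if n is n'.+1 then
    (\1_(dset (lhalf I)) x * (u (rhalf I) x + sibling_sum u n' (lhalf I) x) +
     \1_(dset (rhalf I)) x * (u (lhalf I) x + sibling_sum u n' (rhalf I) x)) / 2
  else 0.

Lemma sibling_sumS u n I P Q x : is_split I P Q -> dset Q x ->
  sibling_sum u n.+1 I x = (u P x + sibling_sum u n Q x) / 2.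
Proof.
move=> s Qx; have h2 : (x \in dset P) = false.
  by apply: memNset; exact: is_split_disj (is_split_sym s) Qx.
move: Qx => /mem_set h1; case: s h1 h2 => -[-> ->] h1 h2 /=.
  by rewrite !indicE h1 h2 mul0r add0r mul1r.
by rewrite !indicE h1 h2 mul0r addr0 mul1r.
Qed.

Lemma sibling_sum_ge0 u n I x : (forall K y, 0 <= u K y) ->
  0 <= sibling_sum u n I x.
Proof.
move=> u0; elim: n I => [//|n IH] I /=.
by rewrite divr_ge0// addr_ge0// mulr_ge0// addr_ge0.
Qed.

Lemma sibling_sum_nondecreasing u n I x : (forall K y, 0 <= u K y) ->
  sibling_sum u n I x <= sibling_sum u n.+1 I x.
Proof.
move=> u0; elim: n I => [|n IH] I; first exact: sibling_sum_ge0.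
rewrite [leRHS]/= [leLHS]/= ler_pM2r//.
by apply: lerD; apply: ler_wpM2l => //; rewrite lerD2l IH.
Qed.

Lemma measurable_sibling_sum u n I : (forall K, measurable_fun setT (u K)) ->
  measurable_fun setT (sibling_sum u n I).
Proof.
move=> mu; elim: n I => [|n IH] I /=; first exact: measurable_cst.
apply: measurable_funM => //; apply: measurable_funD; apply: measurable_funM;
  by [exact: measurable_indic | exact: measurable_funD].
Qed.

(** Jensen's inequality, as an iteration of its midpoint case. The weights only add up to 1 -
    2^(-n); the missing 2^(-n) is carried by the value 0, where the power vanishes as well. *)
Lemma sibling_sum_powR u n I x (p : R) : 1 <= p -> (forall K y, 0 <= u K y) ->
  dset I x ->
  sibling_sum u n I x `^ p <= sibling_sum (fun K y => u K y `^ p) n I x.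
Proof.
move=> p1 u0; elim: n I => [|n IH] I Ix.
  by rewrite /= powR0// gt_eqF// (lt_le_trans ltr01).
have [P [Q [s Qx]]] : exists P Q, is_split I P Q /\ dset Q x.
  move: Ix => /dset_halves[] ?; first by exists (rhalf I), (lhalf I); split=> //; right.
  by exists (lhalf I), (rhalf I); split=> //; left.
rewrite !(sibling_sumS _ _ s Qx).
apply: le_trans (powR_midpoint p1 (u0 _ _) (sibling_sum_ge0 _ _ _ u0)) _.
by rewrite ler_pM2r// lerD2l IH.
Qed.

Section Function.
Variables (b : R -> R[i]).
Hypothesis lb : clocally_integrable b.

Local Notation osc I x := (normc (b x - cmean b I)).

Lemma osc_midpoint I P Q x : is_split I P Q ->
  osc I x <= (osc P x + osc Q x) / 2.
Proof.
move=> s; rewrite (cmean_split s lb) complex_midpointB.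
rewrite normcM normc_real ger0_norm; last by rewrite invr_ge0.
by rewrite mulrC ler_wpM2r ?invr_ge0// normcD.
Qed.

(** Unrolling [osc_midpoint] n times leaves the remainder 2^(-n) |b(x) - <b>_K|, with K the n-th
    descendant around x. Since 2^(-n) <b>_K is the integral of b over K divided by |I|, the
    remainder is controlled by |b(x)| / 2^n and by the smallness of that integral. *)
Lemma osc_sibling_sum n I x (eta : R) : dset I x ->
  (forall K, K \in descendants n I -> normc (cintegral (dset K) b) <= eta) ->
  osc I x <= sibling_sum (fun K y => osc K y) n I x
    + normc (b x) / 2 ^+ n + eta / dlen I.
Proof.
elim: n I => [|n IH] I Ix eK.
  rewrite /= add0r expr0 divr1 (le_trans (normcD _ _))// normc_opp lerD2l.
  have d0 : 0 < (@dlen R I)^-1 by rewrite invr_gt0 dlen_gt0.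
  rewrite /cmean normcM normc_real (ger0_norm (ltW d0)).
  rewrite [leRHS]mulrC ler_pM2l//.
  by apply: eK; rewrite inE.
have [P [Q [s Qx QI]]] : exists P Q, [/\ is_split I P Q, dset Q x &
    forall K, K \in descendants n Q -> K \in descendants n.+1 I].
  move: Ix => /dset_halves[] ?.
    exists (rhalf I), (lhalf I); split=> //; first by right.
    by move=> K KQ; rewrite /= mem_cat KQ.
  exists (lhalf I), (rhalf I); split=> //; first by left.
  by move=> K KQ; rewrite /= mem_cat KQ orbT.
have /(IH _ Qx) {}IH : forall K, K \in descendants n Q ->
  normc (cintegral (dset K) b) <= eta by move=> K /QI; exact: eK.
rewrite (sibling_sumS _ _ s Qx).
apply: le_trans (osc_midpoint x s) _.
move: IH; rewrite (dlen_succ (is_split_level (is_split_sym s))) exprS.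
set D := dlen I; set X := osc Q x; set Y := osc P x.
have D0 : D != 0 by rewrite gt_eqF// dlen_gt0.
set S := sibling_sum _ _ _ _; set B := normc (b x).
(* Passing to a half doubles [eta / dlen], and the factor 1/2 of the midpoint inequality undoes
   this, so the last error term does not change with the depth. *)
have -> : eta / (D / 2) = 2 * (eta / D) by field.
have -> : B / (2 * 2 ^+ n) = (B / 2 ^+ n) / 2 by rewrite invfM; ring.
lra.
Qed.

(** Absolute continuity of the integral, which is uniform over all subsets of J of small measure;
    the real and imaginary parts get e / 2 each. *)
Lemma cintegral_small J (e : R) : 0 < e -> exists n0, forall n, (n0 <= n)%N ->
  forall K, K \in descendants n J -> normc (cintegral (dset K) b) <= e.
Proof.
move=> e0.
have small (h : R -> R) : locally_integrable setT h -> exists2 d : R, 0 < d &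
    forall K, dset K `<=` @dset R J -> dlen K < d ->
     `|\int[leb]_(x in dset K) h x| <= e / 2.
  move=> lh; have iJ := integrable_dset J lh.
  have iT : leb.-integrable setT (EFin \o (h \_ (dset J))).
    by rewrite -restrict_EFin; exact: (iffLR (integrable_mkcond _ _) iJ).
  have [d [d0 hd]] := integral_normr_continuous iT (ltac:(lra) : 0 < e / 2).
  exists d => // K KJ Kd.
  have -> : \int[leb]_(x in dset K) h x = \int[leb]_(x in dset K) (h \_ (dset J)) x.
    apply: eq_Rintegral => x; rewrite inE => /KJ Jx.
    by rewrite patchE mem_set.
  have Kd' : (leb (dset K) < d%:E)%E by rewrite lebesgue_dset lte_fin.
  have := ltW (hd _ (measurable_dset K) Kd').
  apply: le_trans.
  by apply: le_normr_Rintegral => //; exact: integrableS iT.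
case: lb => /small[d1 d10 h1] /small[d2 d20 h2].
pose d := Num.min d1 d2; have d0 : 0 < d by rewrite lt_min d10.
(* Since 2^n > n, this threshold gives 2^n > |J| / d, that is, descendants shorter than d. *)
exists (Num.truncn (dlen J / d)).+1 => n n0n K /(@descendants_ch R)/chP[KJ eK].
have Kd : dlen K < d.
  have J0 := @dlen_gt0 R J; have K0 := @dlen_gt0 R K.
  have lt1 : dlen J / d < 2 ^+ n.
    rewrite (lt_le_trans (truncnS_gt _))//.
    rewrite -natrX ler_nat (leq_trans n0n)// ltnW// ltn_expl//.
  by move: lt1; rewrite ltr_pdivrMr// (dlenD eK) ltr_pM2l//.
apply: le_trans (normc_le_ReIm _) _; rewrite /=.
rewrite [leRHS]splitr lerD//.
  by apply: h1 => //; rewrite (lt_le_trans Kd)// ge_min lexx.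
by apply: h2 => //; rewrite (lt_le_trans Kd)// ge_min lexx orbT.
Qed.

End Function.
End Oscillation.

(** * Weighted p-th power oscillation and summation over siblings *)

Section WeightedOscillation.
Context {R : realType}.
Local Notation leb := (@lebesgue_measure R).
Implicit Types (I J K L P Q : dyadic) (D : set R).
Variables (b : R -> R[i]) (w : R -> R) (p : R).
Hypothesis lb : clocally_integrable b.
Hypothesis mw : measurable_fun setT w.
Hypothesis w0 : forall x, 0 <= w x.
Hypothesis p1 : 1 <= p.

Local Notation osc I x := (normc (b x - cmean b I)).

Let measurableM (f : R -> R) D : measurable_fun setT f ->
  measurable_fun D (fun x => (f x * w x)%:E).
Proof.
move=> mf; apply/measurable_EFinP; apply: measurable_funTS.
exact: measurable_funM.
Qed.

Lemma measurable_osc_powR I : measurable_fun setT (fun x => osc I x `^ p).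
Proof.
apply: measurable_normc_powR; apply: cmeasurableB (cmeasurable_cst _).
exact: clocally_integrable_cmeasurable.
Qed.

Lemma integral_midpoint_le D (f u v : R -> R) (a c : R) : measurable D ->
  measurable_fun setT f -> measurable_fun setT u -> measurable_fun setT v ->
  (forall x, 0 <= f x) -> (forall x, 0 <= u x) -> (forall x, 0 <= v x) ->
  (forall x, D x -> f x <= (u x + v x) / 2) ->
  (\int[leb]_(x in D) (u x * w x)%:E <= a%:E)%E ->
  (\int[leb]_(x in D) (v x * w x)%:E <= c%:E)%E ->
  (\int[leb]_(x in D) (f x * w x)%:E <= ((a + c) / 2)%:E)%E.
Proof.
move=> mD mf mu mv f0 u0 v0 fuv ua vc.
have uw0 x : (0 <= (u x * w x)%:E)%E by rewrite lee_fin mulr_ge0.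
have vw0 x : (0 <= (v x * w x)%:E)%E by rewrite lee_fin mulr_ge0.
apply: (@le_trans _ _ (\int[leb]_(x in D)
    ((2^-1)%:E * ((u x * w x)%:E + (v x * w x)%:E))))%E.
  apply: ge0_le_integral => //.
  - by move=> x _; rewrite lee_fin mulr_ge0.
  - exact: measurableM.
  - by apply: measurable_funeM; apply: emeasurable_funD; exact: measurableM.
  - move=> x Dx; rewrite lee_fin -mulrDl mulrA ler_wpM2r//.
    by rewrite mulrC fuv.
rewrite ge0_integralZl//; last 2 first.
- by apply: emeasurable_funD; exact: measurableM.
- by move=> x _; exact: adde_ge0.
rewrite ge0_integralD//; try exact: measurableM.
by rewrite mulrC EFinM lee_pmul2l// EFinD leeD.
Qed.

Lemma osc_powR_midpoint I P Q x : is_split I P Q ->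
  osc I x `^ p <= (osc P x `^ p + osc Q x `^ p) / 2.
Proof.
move=> s; have p0 : 0 <= p by rewrite (le_trans ler01).
apply: le_trans (powR_midpoint p1 (normc_ge0 _) (normc_ge0 _)).
apply: ge0_ler_powR => //; rewrite ?nnegrE ?divr_ge0 ?addr_ge0 ?normc_ge0//.
exact: osc_midpoint.
Qed.

Section Bounds.
Variables (m : dyadic -> R).
Hypothesis mD : forall J, m J = m (lhalf J) + m (rhalf J).

(** The domain [D] stays fixed while P is halved. Each halving averages two bounds whose masses add
    up to [m P], which gains one factor 1/2; in the application [D] is the sibling of P and [m] the
    mass of mu. *)
Lemma integral_osc_descendants (A : R) n P D : measurable D ->
  (forall K, K \in descendants n P ->
    (\int[leb]_(x in D) (osc K x `^ p * w x)%:E <= (A * m K)%:E)%E) ->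
  (\int[leb]_(x in D) (osc P x `^ p * w x)%:E <= (2 ^- n * A * m P)%:E)%E.
Proof.
move=> mesD; elim: n P => [|n IH] P hK.
  by rewrite expr0 invr1 mul1r hK// inE.
have -> : 2 ^- n.+1 * A * m P =
    (2 ^- n * A * m (lhalf P) + 2 ^- n * A * m (rhalf P)) / 2.
  by rewrite mD exprS invfM; ring.
apply: (integral_midpoint_le (u := fun x => osc (lhalf P) x `^ p)
  (v := fun x => osc (rhalf P) x `^ p)) => //.
- exact: measurable_osc_powR.
- exact: measurable_osc_powR.
- exact: measurable_osc_powR.
- by move=> x; exact: powR_ge0.
- by move=> x; exact: powR_ge0.
- by move=> x; exact: powR_ge0.
- by move=> x _; apply: osc_powR_midpoint; left.
- by apply: IH => K KP; apply: hK; rewrite /= mem_cat KP.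
- by apply: IH => K KP; apply: hK; rewrite /= mem_cat KP orbT.
Qed.

Variable A : R.
Hypothesis osc_sibling : forall I P Q, is_split I P Q ->
  (\int[leb]_(x in dset Q) (osc P x `^ p * w x)%:E <= (A * m P)%:E)%E.
Hypothesis A0 : 0 <= A.
Hypothesis m0 : forall J, 0 <= m J.

Let u I x := osc I x `^ p.

Let u0 I x : 0 <= u I x. Proof. exact: powR_ge0. Qed.

(** The constant does not grow with n: on each half the bound for its sibling and the inductive
    bound for itself average to (A m P + A m Q) / 2, and the two halves together give exactly A m
    I. *)
Lemma integral_sibling_sum n I :
  (\int[leb]_(x in dset I) (sibling_sum u n I x * w x)%:E <= (A * m I)%:E)%E.
Proof.
have ms k J : measurable_fun setT (sibling_sum u k J).
  by apply: measurable_sibling_sum => K; exact: measurable_osc_powR.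
elim: n I => [|n IH] I.
  under eq_integral do rewrite /= mul0r.
  by rewrite integral0 lee_fin mulr_ge0.
rewrite (ge0_integral_split (lhalf_split I)); last 2 first.
- exact: measurableM.
- by move=> x; rewrite lee_fin mulr_ge0// sibling_sum_ge0.
have step P Q : is_split I P Q -> (\int[leb]_(x in dset Q)
    (sibling_sum u n.+1 I x * w x)%:E <= ((A * m P + A * m Q) / 2)%:E)%E.
  move=> s; apply: (integral_midpoint_le (u := u P)
    (v := sibling_sum u n Q)) => //.
  - exact: measurable_osc_powR.
  - by move=> x; exact: sibling_sum_ge0.
  - by move=> x; exact: sibling_sum_ge0.
  - by move=> x Qx; rewrite (sibling_sumS _ _ s Qx).
  - exact: osc_sibling s.
have -> : A * m I = (A * m (rhalf I) + A * m (lhalf I)) / 2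
    + (A * m (lhalf I) + A * m (rhalf I)) / 2 by rewrite mD; field.
rewrite EFinD; apply: leeD; apply: step; [exact: rhalf_split|exact: lhalf_split].
Qed.

Lemma osc_powR_le_limn J x : dset J x ->
  ((osc J x `^ p)%:E <= limn (fun n => (sibling_sum u n J x)%:E))%E.
Proof.
move=> Jx; have p0 : 0 < p by rewrite (lt_le_trans ltr01).
have pn0 : p != 0 by rewrite gt_eqF.
have nd : nondecreasing_seq (fun n => (sibling_sum u n J x)%:E).
  by apply/nondecreasing_seqP => n; rewrite lee_fin sibling_sum_nondecreasing.
have /cvg_lim-> // := ereal_nondecreasing_cvgn nd.
set S := ereal_sup _.
have ub n : ((sibling_sum u n J x)%:E <= S)%E.
  by apply: ereal_sup_ubound; exists n.
case ES : S ub => [s| |] ub; last 2 first.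
- by rewrite leey.
- by have := ub 0%N; rewrite leeNy_eq.
have s0 : 0 <= s by have := ub 0%N; rewrite lee_fin.
(* The finite limit s is written as (s^(1/p))^p, so that the error terms can be compared before
   raising to the power p. *)
rewrite lee_fin -(powRr1 s0) -(mulVf pn0) powRrM.
apply: ge0_ler_powR; rewrite ?nnegrE ?normc_ge0 ?powR_ge0 ?(ltW p0)//.
apply/ler_addgt0Pr => e e0.
have J0 := @dlen_gt0 R J.
(* The tolerance |J| e / 2 becomes e / 2 after the division by |J| in [osc_sibling_sum]. *)
have [n0 hn0] := cintegral_small lb J (ltac:(by rewrite !mulr_gt0) :
  0 < dlen J * (e * 2^-1)).
(* The second argument makes 2^n exceed |b(x)| / (e / 2), so that the term |b(x)| / 2^n takes the
   other e / 2. *)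
pose n := maxn n0 (Num.truncn (normc (b x) / (e / 2))).+1.
have := osc_sibling_sum lb Jx (hn0 n (leq_maxl _ _)).
move/le_trans; apply; rewrite -addrA; apply: lerD.
  rewrite -[leLHS]powRr1; last by apply: sibling_sum_ge0 => *; exact: normc_ge0.
  rewrite -(mulfV pn0) powRrM.
  apply: ge0_ler_powR; rewrite ?nnegrE ?powR_ge0 ?invr_ge0 ?(ltW p0)//.
  apply: le_trans (sibling_sum_powR _ p1 _ Jx) _ => *; first exact: normc_ge0.
  by have := ub n; rewrite lee_fin.
rewrite [leRHS]splitr; apply: lerD; last first.
  by rewrite mulrAC mulfV ?mul1r// gt_eqF.
rewrite ler_pdivrMr ?exprn_gt0// mulrC -ler_pdivrMr ?divr_gt0//.
apply: ltW; apply: (lt_le_trans (truncnS_gt _)); rewrite -natrX ler_nat.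
by rewrite (leq_trans (leq_maxr n0 _))// ltnW// ltn_expl.
Qed.

Lemma integral_osc_le J :
  (\int[leb]_(x in dset J) (osc J x `^ p * w x)%:E <= (A * m J)%:E)%E.
Proof.
have ms k : measurable_fun setT (sibling_sum u k J).
  by apply: measurable_sibling_sum => K; exact: measurable_osc_powR.
have nd x : nondecreasing_seq (fun n => (sibling_sum u n J x * w x)%:E).
  apply/nondecreasing_seqP => n; rewrite lee_fin ler_wpM2r//.
  exact: sibling_sum_nondecreasing.
apply: (@le_trans _ _ (\int[leb]_(x in dset J)
    limn (fun n => (sibling_sum u n J x * w x)%:E)))%E.
  apply: ge0_le_integral => //.
  - by move=> x _; rewrite lee_fin mulr_ge0// powR_ge0.
  - by apply: measurableM; exact: measurable_osc_powR.
  - apply: (emeasurable_fun_cvg (fun n x => (sibling_sum u n J x * w x)%:E)).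
      by move=> n; exact: measurableM.
    by move=> x _; apply: ereal_nondecreasing_is_cvgn.
  - move=> x Jx.
    have -> : limn (fun n => (sibling_sum u n J x * w x)%:E) =
      (limn (fun n => (sibling_sum u n J x)%:E) * (w x)%:E)%E.
      apply/cvg_lim => //; under eq_fun do rewrite EFinM.
      apply: cvgeZr => //; apply: ereal_nondecreasing_is_cvgn.
      by apply/nondecreasing_seqP => n; rewrite lee_fin sibling_sum_nondecreasing.
    by rewrite EFinM lee_wpmul2r ?lee_fin// osc_powR_le_limn.
rewrite monotone_convergence//.
- apply: lime_le.
    apply: ereal_nondecreasing_is_cvgn; apply/nondecreasing_seqP => n.
    apply: ge0_le_integral => //; try exact: measurableM.
    + by move=> x _; rewrite lee_fin mulr_ge0// sibling_sum_ge0.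
    + by move=> x _; move/nondecreasing_seqP : (nd x).
  by apply: nearW => n; exact: integral_sibling_sum.
- by move=> n; exact: measurableM.
- by move=> n x _; rewrite lee_fin mulr_ge0// sibling_sum_ge0.
Qed.

End Bounds.
End WeightedOscillation.

(** * Separated kernel values *)

Section HaarTerms.
Context {R : realType}.
Local Notation leb := (@lebesgue_measure R).
Implicit Types (I J K L P Q : dyadic) (f g : R -> R[i]).

Lemma cintegralZr f z : cintegrable f ->
  cintegral setT (fun x => f x * z%:C) = cintegral setT f * z%:C.
Proof.
move=> [fr fi]; apply: eqc.
  rewrite Re_mul mulr0 subr0 -RintegralZr//; apply: eq_Rintegral => x _.
  by rewrite Re_mul mulr0 subr0.
rewrite Im_mul mulr0 add0r -RintegralZr//; apply: eq_Rintegral => x _.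
by rewrite Im_mul mulr0 add0r.
Qed.

Lemma haar_coef_const f K J : cintegrable f ->
  (forall x, ~ dset K x -> f x = 0) ->
  (forall x : R, dset K x -> haar J x = haar J (dleft K)) ->
  haar_coef f J = cintegral setT f * (haar J (dleft K))%:C.
Proof.
move=> fi fK hJ; rewrite -cintegralZr//; congr cintegral; apply/funext => x.
by have [/hJ ->//|/fK ->] := pselect (dset K x); rewrite !mul0r.
Qed.

Variables (i j : nat) (coef : dyadic -> dyadic -> dyadic -> R[i]).

Definition kernel_term (x y : R) (I : dyadic) : R[i] :=
  \sum_(K \in ch R i I) \sum_(L \in ch R j I)
    coef I K L * (haar K y)%:C * (haar L x)%:C.

Variables (I P Q K L : dyadic).
Hypothesis IPQ : is_split I P Q.
Hypothesis KP : K \in descendants i P.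
Hypothesis LQ : L \in descendants j Q.

(* Only intervals [I' >= I] contribute, and then the Haar functions of [K']
   and [L'] are constant on [K] and [L]. *)
Lemma haar_shift_term_separated f I' x : cintegrable f ->
  (forall y, ~ dset K y -> f y = 0) -> dset L x ->
  haar_shift_term i j coef I' f x =
  cintegral setT f * kernel_term (dleft L) (dleft K) I'.
Proof.
move=> fi fK Lx; rewrite /haar_shift_term /kernel_term mulr_fsumr.
apply: eq_fsbigr => K' /[!inE] /chP[KI' eK'].
rewrite mulr_fsumr; apply: eq_fsbigr => L' /[!inE] /chP[LI' eL'].
have [KsP eK] := chP (@descendants_ch R _ _ _ KP).
have [LsQ eL] := chP (@descendants_ch R _ _ _ LQ).
have eP := is_split_level IPQ; have eQ := is_split_level (is_split_sym IPQ).
rewrite -[in LHS]mulrA -[in RHS]mulrA [RHS]mulrCA; congr (_ * _).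
rewrite mulrA.
(* If I' is at least as long as I, then K' and L' are strictly longer than K and L, and their Haar
   functions are constant there. *)
have [le|lt] := lerP I'.1 I.1.
  rewrite (haar_coef_const fi fK); last first.
    by move=> y Ky; apply: haar_const => //; rewrite eK' eK eP; lia.
  congr (_ * _%:C).
  by apply: haar_const => //; rewrite eL' eL eQ; lia.
(* Otherwise I' is no longer than P. Either it lies in P, and h_{L'} vanishes on L, or it misses P,
   and h_{K'} vanishes on K; both sides are then 0. *)
have PI' : P.1 <= I'.1 by rewrite eP; lia.
have [[z [I'z Pz]]|nz] := pselect (exists z, @dset R I' z /\ dset P z).
  have I'P := dset_nested PI' Pz I'z.
  have hL (y : R) : dset L y -> haar L' y = 0.
    move=> Ly; apply: haar_out => L'y; have Py := I'P _ (LI' _ L'y).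
    by apply: (is_split_disj IPQ Py); exact: LsQ.
  by rewrite !hL ?mulr0//; exact: dleft_dset.
have hK (y : R) : dset K y -> haar K' y = 0.
  move=> Ky; apply: haar_out => K'y; apply: nz; exists y; split.
    exact: KI'.
  exact: KsP.
rewrite (haar_coef_const fi fK).
  by rewrite hK ?mulr0 ?mul0r//; exact: dleft_dset.
by move=> y Ky; rewrite !hK//; exact: dleft_dset.
Qed.

End HaarTerms.

(** * Functions supported in a dyadic interval *)

Section Supported.
Context {R : realType}.
Local Notation leb := (@lebesgue_measure R).
Implicit Types (I J K L : dyadic) (f g : R -> R[i]).

Lemma integrable_supported (h : R -> R) K :
  leb.-integrable (dset K) (EFin \o h) -> (forall x, ~ dset K x -> h x = 0) ->
  leb.-integrable setT (EFin \o h).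
Proof.
move=> hi h0; have -> : EFin \o h = (EFin \o h) \_ (dset K).
  apply/funext => x; rewrite patchE; case: ifPn => //= /negP.
  by rewrite inE => /h0 ->.
exact: (iffLR (integrable_mkcond _ _) hi).
Qed.

Lemma Rintegral_supported (h : R -> R) K : (forall x, ~ dset K x -> h x = 0) ->
  \int[leb]_x h x = \int[leb]_(x in dset K) h x.
Proof.
move=> h0; rewrite [RHS]Rintegral_mkcond; apply: eq_Rintegral => x _.
by rewrite patchE; case: ifPn => //= /negP; rewrite inE => /h0 ->.
Qed.

Lemma cintegral_supported f K : (forall x, ~ dset K x -> f x = 0) ->
  cintegral setT f = cintegral (dset K) f.
Proof.
move=> f0; rewrite /cintegral; congr (_ +i* _); apply: Rintegral_supported => x;
  by move=> /f0 ->.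
Qed.

Lemma bounded_supported f K (M : R) : cmeasurable f ->
  (forall x, normc (f x) <= M) -> (forall x, ~ dset K x -> f x = 0) ->
  inL2 f /\ cintegrable f.
Proof.
move=> mf fM f0; have [mr mi] := mf.
have Kfin : (leb (dset K) < +oo)%E by rewrite lebesgue_dset ltry.
split; last first.
  have bnd (h : R -> R) : measurable_fun setT h -> (forall x, `|h x| <= M) ->
      leb.-integrable (dset K) (EFin \o h).
    move=> mh hM; apply: measurable_bounded_integrable => //.
    - exact: measurable_funTS.
    - exists M; split; first by rewrite num_real.
      by move=> A MA x _ /=; rewrite (le_trans (hM x))// ltW.
  split; apply: (integrable_supported (K := K)); try by move=> x /f0 ->.
    by apply: bnd => // x; apply: le_trans (fM x); exact: normRe_le.
  by apply: bnd => // x; apply: le_trans (fM x); exact: normIm_le.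
split=> //; rewrite /L2norm /wLpnorm poweR_lty//.
apply: (@le_lt_trans _ _ (\int[leb]_(x in dset K) (M `^ 2)%:E)%E).
  rewrite [leRHS]integral_mkcond; apply: ge0_le_integral => //.
  - by move=> x _; rewrite lee_fin mulr1 powR_ge0.
  - apply/measurable_EFinP; under eq_fun do rewrite mulr1.
    exact: measurable_normc_powR.
  - by apply/(measurable_restrictT _ _).1 => //; exact: measurable_cst.
  - move=> x _; rewrite mulr1 patchE; case: ifPn => [_|/negP].
      rewrite lee_fin ge0_ler_powR ?nnegrE ?normc_ge0//.
      by rewrite (le_trans (normc_ge0 (f x))).
    by rewrite inE => /f0 ->; rewrite normc0 powR0 ?pnatr_eq0.
rewrite integral_cst// lte_mul_pinfty ?lee_fin ?powR_ge0//; exact: Kfin.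
Qed.

Lemma measurable_haar J : measurable_fun setT (@haar R J).
Proof.
apply: measurable_funM => //; apply: measurable_funB;
  exact: measurable_indic.
Qed.

Lemma cmeasurable_haar_shift_term i j coef J f :
  cmeasurable (haar_shift_term i j coef J f).
Proof.
have -> : haar_shift_term i j coef J f = fun x =>
    \sum_(K <- fset_set (ch R i J)) \sum_(L <- fset_set (ch R j J))
    coef J K L * haar_coef f K * (haar L x)%:C.
  apply/funext => x; rewrite /haar_shift_term fsbig_finite/=; last exact: ch_finite.
  by apply: eq_bigr => K _; rewrite fsbig_finite//; exact: ch_finite.
apply: cmeasurable_sum => K.
apply: cmeasurable_sum => L; apply: cmeasurableM (cmeasurable_cst _) _.
exact: cmeasurable_real (measurable_haar _).
Qed.

Definition cindic K (x : R) : R[i] := (\1_(dset K) x)%:C.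

Lemma cmeasurable_cindic K : cmeasurable (cindic K).
Proof. by apply: cmeasurable_real; exact: measurable_indic. Qed.

Lemma cindic_in K x : dset K x -> cindic K x = 1.
Proof. by move=> Kx; rewrite /cindic indicE mem_set. Qed.

Lemma cindic_out K x : ~ dset K x -> cindic K x = 0.
Proof. by move=> nK; rewrite /cindic indicE memNset. Qed.

Lemma normc_cindic_le1 K x : normc (cindic K x) <= 1.
Proof.
have [/cindic_in ->|/cindic_out ->] := pselect (dset K x).
  by rewrite normc1.
by rewrite normc0.
Qed.

Lemma cintegral_cindic K : cintegral setT (cindic K) = (dlen K)%:C.
Proof.
apply: eqc; last by rewrite /= /Rintegral integral0.
rewrite /= /Rintegral integral_indic// setIT.
by have := @lebesgue_dset R K; move=> /(congr1 fine).
Qed.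

End Supported.

#[local] Existing Instance totally_filter.

(** * Kernel values as limits of partial sums in L^2 *)

Section L2Limit.
Context {R : realType}.
Local Notation leb := (@lebesgue_measure R).
Implicit Types (f g v : R -> R[i]) (z : R[i]).

Lemma sqr_normc_triangle (z1 z2 z3 : R[i]) :
  normc (z1 - z3) ^+ 2 <= 2 * normc (z1 - z2) ^+ 2 + 2 * normc (z2 - z3) ^+ 2.
Proof.
have := normcD (z1 - z2) (z2 - z3); rewrite addrA subrK.
have := normc_ge0 (z1 - z3); set a := normc _; set b := normc _; set c := normc _.
move=> a0 abc; apply: (@le_trans _ _ ((b + c) ^+ 2)).
  by rewrite ler_pXn2r ?nnegrE ?addr_ge0 ?normc_ge0.
by have := sqr_ge0 (b - c); lra.
Qed.

Let measurable_sqr v z (D : set R) : cmeasurable v ->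
  measurable_fun D (fun x => (normc (v x - z) ^+ 2)%:E).
Proof.
move=> mv; apply/measurable_EFinP; apply: measurable_funTS.
apply: measurable_funX; apply: measurable_normc.
exact: cmeasurableB mv (cmeasurable_cst _).
Qed.

Lemma integral_dset_cst (r : R) L :
  (\int[leb]_(x in dset L) r%:E = (r * dlen L)%:E)%E.
Proof. by rewrite integral_cst//; have := @lebesgue_dset R L; rewrite EFinM => <-. Qed.

(** Turns approximation in L^2 by functions constant on L into closeness of the constants
    themselves. *)
Lemma sqr_dist_constants v z1 z2 L (d1 d2 : R) : cmeasurable v ->
  (\int[leb]_(x in dset L) (normc (v x - z1) ^+ 2)%:E <= d1%:E)%E ->
  (\int[leb]_(x in dset L) (normc (v x - z2) ^+ 2)%:E <= d2%:E)%E ->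
  normc (z1 - z2) ^+ 2 * dlen L <= 2 * d1 + 2 * d2.
Proof.
move=> mv h1 h2; rewrite -lee_fin -integral_dset_cst.
apply: (@le_trans _ _ (\int[leb]_(x in dset L)
   (2%:E * (normc (v x - z1) ^+ 2)%:E + 2%:E * (normc (v x - z2) ^+ 2)%:E)))%E.
  apply: ge0_le_integral => //.
  - by move=> x _; rewrite lee_fin sqr_ge0.
  - by apply: emeasurable_funD; apply: measurable_funeM; exact: measurable_sqr.
  - move=> x _; rewrite -!EFinM -EFinD lee_fin (normcB (v x) z1).
    exact: sqr_normc_triangle.
rewrite ge0_integralD//; last 4 first.
- by move=> x _; rewrite -EFinM lee_fin mulr_ge0 ?sqr_ge0.
- by apply: measurable_funeM; exact: measurable_sqr.
- by move=> x _; rewrite -EFinM lee_fin mulr_ge0 ?sqr_ge0.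
- by apply: measurable_funeM; exact: measurable_sqr.
rewrite !ge0_integralZl_EFin//; try exact: measurable_sqr;
  try by move=> x _; rewrite lee_fin sqr_ge0.
by rewrite [leRHS]EFinD !(EFinM 2); apply: leeD; apply: lee_wpmul2l.
Qed.

Lemma sqr_dist_function v z1 z2 L (d : R) : cmeasurable v ->
  (\int[leb]_(x in dset L) (normc (v x - z1) ^+ 2)%:E <= d%:E)%E ->
  (\int[leb]_(x in dset L) (normc (v x - z2) ^+ 2)%:E <=
   (2 * d + 2 * (normc (z1 - z2) ^+ 2 * dlen L))%:E)%E.
Proof.
move=> mv h1.
apply: (@le_trans _ _ (\int[leb]_(x in dset L)
   (2%:E * (normc (v x - z1) ^+ 2)%:E + (2 * normc (z1 - z2) ^+ 2)%:E)))%E.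
  apply: ge0_le_integral => //.
  - by move=> x _; rewrite lee_fin sqr_ge0.
  - exact: measurable_sqr.
  - apply: emeasurable_funD; last exact: measurable_cst.
    by apply: measurable_funeM; exact: measurable_sqr.
  - by move=> x _; rewrite -!EFinM -EFinD lee_fin sqr_normc_triangle.
rewrite ge0_integralD//; last 3 first.
- by move=> x _; rewrite -EFinM lee_fin mulr_ge0 ?sqr_ge0.
- by apply: measurable_funeM; exact: measurable_sqr.
- by move=> x _; rewrite lee_fin mulr_ge0 ?sqr_ge0.
rewrite !ge0_integralZl_EFin//; try exact: measurable_sqr;
  try by move=> x _; rewrite lee_fin sqr_ge0.
rewrite integral_dset_cst [leRHS]EFinD -mulrA; apply: leeD => //.
by rewrite (EFinM 2); apply: lee_wpmul2l.
Qed.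

Variables (i j : nat) (coef : dyadic -> dyadic -> dyadic -> R[i]).
Variables (T : (R -> R[i]) -> R -> R[i]).
Hypothesis hT : is_haar_shift i j coef T.
Variables (I P Q K L : dyadic).
Hypothesis IPQ : is_split I P Q.
Hypothesis KP : K \in descendants i P.
Hypothesis LQ : L \in descendants j Q.

Let u := kernel_term i j coef (dleft L) (dleft K).
Let S (F : {fset dyadic}) := \sum_(I' <- F) u I'.

(** On L the partial sums of the Haar series are the constants [cintegral setT f * S F], so the
    convergence in L^2 on the line is simply restricted to L. *)
Lemma near_partial_sums f (M e : R) : cmeasurable f ->
  (forall x, normc (f x) <= M) -> (forall x, ~ dset K x -> f x = 0) -> 0 < e ->
  \forall F \near totally, (\int[leb]_(x in dset L)
     (normc (T f x - cintegral setT f * S F) ^+ 2)%:E <= e%:E)%E.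
Proof.
move=> mf fM f0 e0; have [f2 f1] := bounded_supported mf fM f0.
have se0 : 0 < Num.sqrt e by rewrite sqrtr_gt0.
pose err (F : {fset dyadic}) x :=
  T f x - \sum_(I' <- F) haar_shift_term i j coef I' f x.
have near_lt : \forall F \near totally, (L2norm (err F) < (Num.sqrt e)%:E)%E.
  have /(_ [set y | (y < (Num.sqrt e)%:E)%E]) := haar_shift_L2_series hT f2.
  apply.
  apply: open_nbhs_nbhs; split; first exact: open_ereal_lt_ereal.
  by rewrite /= lte_fin.
near=> F.
have /ltW : (L2norm (err F) < (Num.sqrt e)%:E)%E by near: F.
rewrite /L2norm /wLpnorm; set X := (\int[_]_x _)%E => Xe.
have X0 : (0 <= X)%E.
  by apply: integral_ge0 => x _; rewrite lee_fin mulr1 powR_ge0.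
have {}Xe : (X <= e%:E)%E.
  rewrite -(poweRe1 X0) -[1](@mulVf _ (2 : R)) ?pnatr_eq0// poweRrM.
  have -> : e%:E = (((Num.sqrt e)%:E `^ 2))%E.
    by rewrite poweR_EFin powR_mulrn ?sqrtr_ge0// sqr_sqrtr// ltW.
  apply: gt0_ler_poweR => //; by rewrite in_itv /= ?leey ?andbT ?poweR_ge0.
apply: le_trans Xe; rewrite /X.
pose g x := (normc (err F x) `^ 2 * cst 1 x)%:E.
rewrite (_ : (\int[leb]_(x in dset L) _ = \int[leb]_(x in dset L) g x)%E).
  apply: ge0_subset_integral => //.
  - apply/measurable_EFinP; apply: measurable_funM => //.
    apply: measurable_normc_powR; apply: cmeasurableB.
      exact: haar_shift_L2_measurable hT f f2.
    by apply: cmeasurable_sum => I'; exact: cmeasurable_haar_shift_term.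
  - by move=> x _; rewrite lee_fin mulr1 powR_ge0.
apply: eq_integral => x /[!inE] Lx; rewrite /g mulr1 powR_mulrn ?normc_ge0//.
congr ((normc (_ - _) ^+ 2)%:E); rewrite mulr_sumr; apply: eq_bigr => I' _.
by rewrite (haar_shift_term_separated coef IPQ KP LQ _ f1 f0 Lx).
Unshelve. all: by end_near. Qed.

(** The test function 1_K has the nonzero integral |K|, so the numbers [S F] can be read off from
    approximations of the single function T 1_K on L. *)
Lemma partial_sums_cauchy (e : R) : 0 < e -> exists z : R[i],
  \forall F \near totally, normc (z - S F) < e.
Proof.
move=> e0; have K0 := @dlen_gt0 R K; have L0 := @dlen_gt0 R L.
(* Two approximations with error d give |K|^2 |S F0 - S F|^2 |L| <= 4 d, which is half of e^2 |K|^2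
   |L|; the spare half makes the inequality strict. *)
pose d := e ^+ 2 * dlen K ^+ 2 * dlen L / 8.
have d0 : 0 < d by rewrite !mulr_gt0// exprn_gt0.
have nS := near_partial_sums (cmeasurable_cindic K) (normc_cindic_le1 K)
  (@cindic_out R K) d0.
have [F0 hF0] := filter_ex nS; exists (S F0); near=> F.
have hF : (\int[leb]_(x in dset L)
     (normc (T (cindic K) x - cintegral setT (cindic K) * S F) ^+ 2)%:E <= d%:E)%E by near: F.
have mT : cmeasurable (T (cindic K)).
  have [f2 _] := bounded_supported (cmeasurable_cindic K) (normc_cindic_le1 K)
    (@cindic_out R K).
  exact: haar_shift_L2_measurable hT _ f2.
have := sqr_dist_constants mT hF0 hF.
rewrite -mulrBr normcM cintegral_cindic normc_real (ger0_norm (ltW K0)).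
move=> h; rewrite -(@ltr_pXn2r _ 2) ?nnegrE ?normc_ge0 ?(ltW e0)//.
have c0 : 0 < dlen K ^+ 2 * dlen L :> R by rewrite mulr_gt0// exprn_gt0.
rewrite -(ltr_pM2r c0).
apply: le_lt_trans (_ : e ^+ 2 * (dlen K ^+ 2 * dlen L) / 2 < _).
  rewrite exprMn -mulrA mulrCA in h; apply: le_trans h _.
  by rewrite /d; lra.
by rewrite ltr_pdivrMr// ltr_pMr ?mulr_gt0 ?exprn_gt0// ltr1n.
Unshelve. all: by end_near. Qed.

(** [csum] is built from limits, which say something about the partial sums only once these
    converge. The Cauchy property and the completeness of R, applied to the real and imaginary
    parts, provide this. *)
Lemma near_csum (e : R) : 0 < e -> \forall F \near totally, normc (csum u - S F) < e.
Proof.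
have cvgS (pr : R[i] -> R) : (forall s (G : dyadic -> R[i]),
      pr (\sum_(I' <- s) G I') = \sum_(I' <- s) pr (G I')) ->
    (forall z w, `|pr z - pr w| <= normc (z - w)) ->
    (fun F => pr (S F)) @ totally --> sum (fun I' => pr (u I')).
  move=> pr_sum pr_le.
  have eS F : partial_sum (fun I' => pr (u I')) F = pr (S F).
    by rewrite /S pr_sum /partial_sum big_seq_fsetE.
  have <- : partial_sum (fun I' => pr (u I')) = (fun F => pr (S F)) by exact/funext.
  rewrite /sum; apply/cauchy_cvgP/cauchy_exP => d d0.
  have [z hz] := partial_sums_cauchy d0; exists (pr z).
  apply: filterS hz => F hF; rewrite /= /ball/= eS.
  exact: le_lt_trans (pr_le _ _) hF.
move=> e0; have e20 : 0 < e / 2 by rewrite divr_gt0.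
have hr := cvgS (@complex.Re R) (fun s G => Re_sum s G) (fun z w =>
  ltac:(by rewrite -Re_opp -Re_add normRe_le)).
have hi := cvgS (@complex.Im R) (fun s G => Im_sum s G) (fun z w =>
  ltac:(by rewrite -Im_opp -Im_add normIm_le)).
near=> F.
apply: le_lt_trans (normc_le_ReIm _) _.
rewrite Re_add Im_add Re_opp Im_opp [ltRHS]splitr; apply: ltrD.
  by near: F; move/cvgrPdist_lt : hr; apply.
by near: F; move/cvgrPdist_lt : hi; apply.
Unshelve. all: by end_near. Qed.

Lemma haar_shift_bounded_separated f (M : R) : cmeasurable f ->
  (forall x, normc (f x) <= M) -> (forall x, ~ dset K x -> f x = 0) ->
  {ae leb, forall x, dset L x ->
    T f x = cintegral setT f * haar_kernel i j coef (dleft L) (dleft K)}.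
Proof.
move=> mf fM fK; set z := cintegral setT f.
set a := haar_kernel _ _ _ _ _.
have mT : cmeasurable (T f).
  by have [f2 _] := bounded_supported mf fM fK; exact: haar_shift_L2_measurable hT _ f2.
have L0 := @dlen_gt0 R L.
have X0 : (\int[leb]_(x in dset L) (normc (T f x - z * a) ^+ 2)%:E = 0)%E.
  apply/eqP; rewrite eq_le; apply/andP; split; last first.
    by apply: integral_ge0 => x _; rewrite lee_fin sqr_ge0.
  apply/lee_addgt0Pr => e e0; rewrite add0e.
  (* The final bound is 2 d + 2 d. The summand 1 in [N] keeps the quotient d / N meaningful when the
     integral of f is zero. *)
  pose d := e / 4.
  pose N := normc z ^+ 2 * dlen L + 1.
  have N0 : 0 < N by rewrite ltr_pwDr// mulr_ge0 ?sqr_ge0 ?(ltW L0).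
  have [F [h1 h2]] : exists F, (\int[leb]_(x in dset L)
     (normc (T f x - z * S F) ^+ 2)%:E <= d%:E)%E /\
     normc (a - S F) < Num.sqrt (d / N).
    apply: (@filter_ex _ totally); near=> F; split; near: F.
      by apply: (near_partial_sums mf fM fK); rewrite divr_gt0.
    by apply: near_csum; rewrite sqrtr_gt0 !divr_gt0.
  apply: le_trans (sqr_dist_function (z * a) mT h1) _; rewrite lee_fin.
  rewrite -mulrBr normcM normcB exprMn.
  have h3 : normc (a - S F) ^+ 2 <= d / N.
    have dN : 0 <= d / N by rewrite !divr_ge0// ltW.
    by rewrite -(sqr_sqrtr dN) ler_pXn2r ?nnegrE ?normc_ge0 ?sqrtr_ge0// ltW.
  have h4 : normc z ^+ 2 * normc (a - S F) ^+ 2 * dlen L <= d.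
    rewrite mulrAC; apply: (@le_trans _ _ (N * (d / N))); last first.
      by rewrite mulrC divfK// gt_eqF.
    have z0 : 0 <= normc z ^+ 2 * dlen L by rewrite mulr_ge0 ?sqr_ge0 ?(ltW L0).
    by apply: (ler_pM z0 (sqr_ge0 _) _ h3); rewrite lerDl.
  by rewrite /d in h4 *; lra.
have mX : measurable_fun (dset L) (fun x => (normc (T f x - z * a) ^+ 2)%:E).
  exact: measurable_sqr.
have Xa : (\int[leb]_(x in dset L) `|(normc (T f x - z * a) ^+ 2)%:E| = 0)%E.
  by rewrite -[RHS]X0; apply: eq_integral => x _; rewrite gee0_abs// lee_fin sqr_ge0.
have := (iffLR (ae_eq_integral_abs leb (measurable_dset L) mX) Xa).
apply: filterS => x /[apply] /= -[] /eqP.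
by rewrite sqrf_eq0 => /eqP/eq0_normc/eqP; rewrite subr_eq0 => /eqP.
Unshelve. all: by end_near. Qed.

End L2Limit.

(** * Extension to integrable functions *)

#[local] Instance ae_lebesgue_filter (R : realType) :
  Filter (nbhs (almost_everywhere (@lebesgue_measure R))).
Proof. exact: (@ae_filter_ringOfSetsType _ _ R (@lebesgue_measure R)). Qed.

Section WeakTypeExtension.
Context {R : realType}.
Local Notation leb := (@lebesgue_measure R).
Implicit Types (f g b : R -> R[i]) (z : R[i]).

Lemma cintegrable_cmeasurable f : cintegrable f -> cmeasurable f.
Proof.
by move=> [/integrableP[/measurable_EFinP mr _] /integrableP[/measurable_EFinP mi _]].
Qed.

Lemma integrable_normc f : cintegrable f ->
  leb.-integrable setT (fun x => (normc (f x))%:E).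
Proof.
move=> fi; have [fr fim] := fi.
have gi : leb.-integrable setT ((abse \o (EFin \o (fun x => Re (f x)))) \+
     (abse \o (EFin \o (fun x => Im (f x)))))%E.
  by apply: integrableD => //; exact: integrable_abse.
apply: le_integrable gi => //.
  apply/measurable_EFinP; apply: measurable_normc.
  exact: cintegrable_cmeasurable.
move=> x _; rewrite /= lee_fin ger0_norm ?normc_ge0//.
by rewrite ger0_norm ?addr_ge0// normc_le_ReIm.
Qed.

Lemma cintegrable_dominated f g : cmeasurable f -> cintegrable g ->
  (forall x, normc (f x) <= normc (g x)) -> cintegrable f.
Proof.
move=> [mr mi] /integrable_normc gi fg; split.
  apply: le_integrable gi => //; first exact/measurable_EFinP.
  move=> x _; rewrite /= lee_fin [leRHS]ger0_norm ?normc_ge0//.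
  exact: le_trans (normRe_le _) (fg x).
apply: le_integrable gi => //; first exact/measurable_EFinP.
move=> x _; rewrite /= lee_fin [leRHS]ger0_norm ?normc_ge0//.
exact: le_trans (normIm_le _) (fg x).
Qed.

Lemma cintegralB f g : cintegrable f -> cintegrable g ->
  cintegral setT (fun x => f x - g x) = cintegral setT f - cintegral setT g.
Proof.
move=> [fr fi] [gr gi]; apply: eqc.
  rewrite Re_add Re_opp -RintegralB//; apply: eq_Rintegral => x _.
  by rewrite Re_add Re_opp.
rewrite Im_add Im_opp -RintegralB//; apply: eq_Rintegral => x _.
by rewrite Im_add Im_opp.
Qed.

(** The factor 2 comes from bounding the real and imaginary parts separately; it is harmless, since
    the right-hand side will tend to 0. *)
Lemma normc_cintegral_le f : cintegrable f ->
  ((normc (cintegral setT f))%:E <= 2%:E * \int[leb]_x (normc (f x))%:E)%E.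
Proof.
move=> fi; have [fr fim] := fi; have mf := cintegrable_cmeasurable fi.
have part (h : R -> R) : leb.-integrable setT (EFin \o h) ->
    (forall x, `|h x| <= normc (f x)) ->
    (`|\int[leb]_x h x|%:E <= \int[leb]_x (normc (f x))%:E)%E.
  move=> hi hf; have [mh _] := integrableP _ _ _ hi.
  rewrite EFin_normr_Rintegral//.
  apply: le_trans (le_abse_integral _ _ _) _ => //.
  apply: ge0_le_integral => //.
  - exact: measurableT_comp.
  - by apply/measurable_EFinP; exact: measurable_normc.
  - by move=> x _; rewrite lee_fin.
have -> : 2%:E = (1 + 1)%E :> \bar R by rewrite -EFinD.
rewrite ge0_muleDl// !mul1e.
apply: (@le_trans _ _ (`|\int[leb]_x Re (f x)| + `|\int[leb]_x Im (f x)|)%:E).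
  by rewrite lee_fin normc_le_ReIm.
rewrite EFinD; apply: leeD; apply: part => // x; [exact: normRe_le|exact: normIm_le].
Qed.

(** Truncations of a function supported in K are bounded, hence within reach of the L^2 series. The
    product with an indicator reduces measurability to that of products. *)
Definition ctruncate f (n : nat) (x : R) : R[i] :=
  f x * (\1_[set y | normc (f y) <= n%:R] x : R)%:C.

Lemma ctruncateP f n x :
  ctruncate f n x = if normc (f x) <= n%:R then f x else 0.
Proof.
rewrite /ctruncate indicE; case: ifPn => h.
  by rewrite mem_set// mulr1.
by rewrite memNset ?mulr0//; apply/negP.
Qed.

Lemma cmeasurable_ctruncate f n : cmeasurable f -> cmeasurable (ctruncate f n).
Proof.
move=> mf; apply: cmeasurableM => //; apply: cmeasurable_real.
apply: measurable_indic.
have -> : [set y | normc (f y) <= n%:R] =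
   setT `&` (fun y => normc (f y)) @^-1` `]-oo, n%:R].
  by apply/seteqP; split=> x /=; rewrite in_itv//= => -[].
exact: measurable_normc.
Qed.

Lemma ctruncate_cvg f : cintegrable f ->
  (\int[leb]_x (normc (f x - ctruncate f n x))%:E)%E @[n --> \oo] --> 0%E.
Proof.
move=> fi; have mf := cintegrable_cmeasurable fi.
have mfn n : cmeasurable (fun x => f x - ctruncate f n x).
  by apply: cmeasurableB => //; exact: cmeasurable_ctruncate.
have -> : 0%E = (\int[leb]_x (cst 0 x : \bar R))%E by rewrite integral0.
have [//|||_ _] := @dominated_convergence _ _ R leb setT measurableT
  (fun n x => (normc (f x - ctruncate f n x))%:E) (cst 0)%E
  (fun x => (normc (f x))%:E) _ (measurable_cst _) _ (integrable_normc fi).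
- by move=> n; apply/measurable_EFinP; exact: measurable_normc.
- apply: aeW => x _; apply: cvg_near_cst; exists (Num.truncn (normc (f x))).+1 => //.
  move=> n /= hn; rewrite ctruncateP ifT ?subrr ?normc0//.
  apply: ltW; apply: (lt_le_trans (truncnS_gt _)); rewrite ler_nat//.
- apply: aeW => x n _; rewrite gee0_abs ?lee_fin ?normc_ge0// ctruncateP.
  by case: ifPn; rewrite ?subrr ?subr0// normc0 normc_ge0.
- by [].
Qed.

Variables (i j : nat) (coef : dyadic -> dyadic -> dyadic -> R[i]).
Variables (T : (R -> R[i]) -> R -> R[i]).
Hypothesis hT : is_haar_shift i j coef T.
Variables (I P Q K L : dyadic).
Hypothesis IPQ : is_split I P Q.
Hypothesis KP : K \in descendants i P.
Hypothesis LQ : L \in descendants j Q.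

Let a := haar_kernel i j coef (dleft L) (dleft K).

(** Almost everywhere on L, T g - z a = T (g - g_n) + (z_n - z) a, with g_n the truncations and z,
    z_n the integrals of g, g_n. Once the last term is at most t / 2, the exceptional set is
    contained, up to a null set, in {|T (g - g_n)| > t / 2}, whose measure tends to 0 by the weak
    type bound. *)
Lemma haar_shift_separated_level g (t : R) : cintegrable g ->
  (forall x, ~ dset K x -> g x = 0) -> 0 < t ->
  leb (dset L `&` [set x | t < normc (T g x - cintegral setT g * a)]) = 0%E.
Proof.
move=> gi gK t0; have mg := cintegrable_cmeasurable gi.
set z := cintegral setT g; pose gn := ctruncate g; pose zn n := cintegral setT (gn n).
have le_gn n x : normc (gn n x) <= normc (g x).
  by rewrite /gn ctruncateP; case: ifPn; rewrite ?normc0 ?normc_ge0.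
have gni n : cintegrable (gn n).
  exact: cintegrable_dominated (cmeasurable_ctruncate n mg) gi (le_gn n).
have gdi n : cintegrable (fun x => g x - gn n x).
  apply: cintegrable_dominated gi _.
    by apply: cmeasurableB => //; exact: cmeasurable_ctruncate.
  move=> x; rewrite /gn ctruncateP.
  by case: ifPn; rewrite ?subrr ?subr0// normc0 normc_ge0.
have gn_bounded n x : normc (gn n x) <= n%:R.
  by rewrite /gn ctruncateP; case: ifPn => //; rewrite normc0.
have gnK n x : ~ dset K x -> gn n x = 0.
  by rewrite /gn ctruncateP => /gK ->; case: ifP.
have mT h : cintegrable h -> cmeasurable (T h).
  by move=> hi; exact: haar_shift_L1_measurable hT h hi.
have mset (h : R -> R) (r : R) : measurable_fun setT h ->
    measurable [set x | r < h x].
  move=> mh; have -> : [set x | r < h x] = setT `&` h @^-1` `]r, +oo[.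
    by apply/seteqP; split=> x /=; rewrite in_itv/= andbT// => -[].
  exact: mh.
set E := _ `&` _.
have mE : measurable E.
  apply: measurableI => //; apply: mset; apply: measurable_normc.
  exact: cmeasurableB (mT _ gi) (cmeasurable_cst _).
have [C weak] := haar_shift_weak11 hT.
pose B n := (\int[leb]_x (normc (g x - gn n x))%:E)%E.
have Bcvg : B @ \oo --> 0%E by exact: ctruncate_cvg.
have t20 : 0 < t / 2 by rewrite divr_gt0.
have small : \forall n \near \oo, normc a * normc (z - zn n) <= t / 2.
  (* Chosen so that (|a| + 1) 2 d = t / 2, where the 2 is that of [normc_cintegral_le]; adding 1
     avoids dividing by zero when a = 0. *)
  pose d := t / 2 / (2 * (normc a + 1)).
  have a10 : 0 < normc a + 1 by rewrite ltr_pwDr ?normc_ge0.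
  have d0 : 0 < d by rewrite /d !divr_gt0// mulr_gt0.
  have : \forall n \near \oo, (B n < d%:E)%E.
    have /(_ [set y | (y < d%:E)%E]) := Bcvg; apply.
    by apply: open_nbhs_nbhs; split; [exact: open_ereal_lt_ereal|rewrite /= lte_fin].
  apply: filterS => n /ltW Bd.
  have : ((normc (z - zn n))%:E <= 2%:E * d%:E)%E.
    rewrite /z /zn -cintegralB//; apply: le_trans (normc_cintegral_le _) _ => //.
    exact: lee_wpmul2l.
  rewrite -EFinM lee_fin => h.
  apply: (@le_trans _ _ ((normc a + 1) * (2 * d))).
    by apply: ler_pM; rewrite ?normc_ge0// lerDl.
  by rewrite /d le_eqVlt; apply/orP; left; apply/eqP; field; rewrite gt_eqF.
have bound : \forall n \near \oo, (leb E <= (C / (t / 2))%:E * B n)%E.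
  move: small; apply: filterS => n hn.
  apply: le_trans (weak _ (gdi n) _ t20).
  set W := [set x | _].
  have mW : measurable W by apply: mset; apply: measurable_normc; exact: mT.
  (* E is contained in W only almost everywhere, so the measures are compared as integrals of
     indicators. *)
  have -> : leb E = (\int[leb]_x (\1_E x)%:E)%E.
    by rewrite integral_indic// setIT.
  have -> : leb W = (\int[leb]_x (\1_W x)%:E)%E.
    by rewrite integral_indic// setIT.
  apply: ae_ge0_le_integral => //.
  - by apply/measurable_EFinP; exact: measurable_indic.
  - by apply/measurable_EFinP; exact: measurable_indic.
  have lin : {ae leb, forall x,
      T g x = 1 * T (fun y => g y - gn n y) x + T (gn n) x}.
    have eg : (fun y => 1 * (g y - gn n y) + gn n y) = g.
      by apply/funext => y; rewrite mul1r subrK.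
    by have := haar_shift_L1_linear hT 1 (gdi n) (gni n); rewrite eg.
  have rep : {ae leb, forall x, dset L x -> T (gn n) x = zn n * a}.
    by have := haar_shift_bounded_separated hT IPQ KP LQ
      (cmeasurable_ctruncate n mg) (gn_bounded n) (@gnK n).
  move: lin rep; apply: filterS2 => x lin rep _.
  rewrite lee_fin !indicE.
  have [/[!inE] -[Lx Ex]|] := boolP (x \in E); last by rewrite ler0n.
  rewrite mem_set//; rewrite /W /= -/(gn n).
  have := normcD (T (fun y => g y - gn n y) x) ((zn n - z) * a).
  have -> : T (fun y => g y - gn n y) x + (zn n - z) * a = T g x - z * a.
    by rewrite lin mul1r (rep Lx) mulrBl addrA.
  rewrite normcM (normcB (zn n)) [_ * normc a]mulrC => h; move: Ex hn h => /=.
  set u := normc (T g x - _); set v := normc (T _ x); lra.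
apply/eqP; rewrite -measure_le0.
have cv : ((C / (t / 2))%:E * B n)%E @[n --> \oo] --> 0%E.
  by rewrite -(mule0 (C / (t / 2))%:E); exact: cvgeZl.
by rewrite -(cvg_lim _ cv)//; apply: lime_ge bound; apply/cvg_ex; exists 0%E.
Qed.

Lemma haar_shift_separated g : cintegrable g ->
  (forall x, ~ dset K x -> g x = 0) ->
  {ae leb, forall x, dset L x -> T g x = cintegral setT g * a}.
Proof.
move=> gi gK.
have lev k : {ae leb, forall x, dset L x ->
    normc (T g x - cintegral setT g * a) <= k.+1%:R^-1}.
  have k0 : 0 < k.+1%:R^-1 :> R by rewrite invr_gt0.
  have E0 := haar_shift_separated_level gi gK k0.
  exists (dset L `&` [set x | k.+1%:R^-1 < normc (T g x - cintegral setT g * a)]).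
  split=> //; last first.
    by move=> x /not_implyP[Lx] /negP; rewrite -ltNge => ?; split.
  apply: measurableI => //.
  have -> : [set x | k.+1%:R^-1 < normc (T g x - cintegral setT g * a)] =
     setT `&` (fun x => normc (T g x - cintegral setT g * a)) @^-1` `]k.+1%:R^-1, +oo[.
    by apply/seteqP; split=> x /=; rewrite in_itv/= andbT// => -[].
  apply: measurable_normc => //; apply: cmeasurableB (cmeasurable_cst _).
  exact: haar_shift_L1_measurable hT g gi.
have := ae_foralln lev; apply: filterS => x h Lx.
apply/eqP; rewrite -subr_eq0; apply/eqP/eq0_normc/eqP.
rewrite eq_le normc_ge0 andbT; apply/ler_addgt0Pr => e e0; rewrite add0r.
(* At this level k one has k + 1 > 1 / e. *)
apply: le_trans (h (Num.truncn e^-1) Lx) _.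
rewrite -[leRHS]invrK lef_pV2 ?posrE ?invr_gt0//.
by apply: ltW; exact: truncnS_gt.
Qed.

End WeakTypeExtension.

(** * Testing the commutator *)

Section Commutator.
Context {R : realType}.
Local Notation leb := (@lebesgue_measure R).
Implicit Types (f g b : R -> R[i]) (w : R -> R) (z : R[i]).

Lemma ae_dset_seq (s : seq dyadic) (A : R -> Prop) :
  (forall L, L \in s -> {ae leb, forall x, dset L x -> A x}) ->
  {ae leb, forall x, (exists2 L, L \in s & dset L x) -> A x}.
Proof.
elim: s => [|L s IH] h; first by apply: nearW => x [].
have hs : {ae leb, forall x, (exists2 L, L \in s & dset L x) -> A x}.
  by apply: IH => L' L's; apply: h; rewrite inE L's orbT.
move: hs (h L (mem_head _ _)); apply: filterS2 => x hs hL [L'].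
by rewrite inE => /orP[/eqP -> /hL//|L's L'x]; apply: hs; exists L'.
Qed.

(** The kernel value depends on L, so identities for T hold almost everywhere on one L at a time;
    finitely many L cover the half Q. *)
Lemma ae_descendants n I (A : R -> Prop) :
  (forall L, L \in descendants n I -> {ae leb, forall x, dset L x -> A x}) ->
  {ae leb, forall x, dset I x -> A x}.
Proof.
move=> /ae_dset_seq; apply: filterS => x h Ix; apply: h.
exact: descendants_cover.
Qed.

Section Kernel.
Variables (i j : nat) (coef : dyadic -> dyadic -> dyadic -> R[i]).
Variables (T : (R -> R[i]) -> R -> R[i]) (b : R -> R[i]) (c : R).
Hypothesis hT : is_haar_shift i j coef T.
Hypothesis c0 : 0 < c.
Hypothesis nondeg : nondegenerate_kernel i j coef c.
Hypothesis lb : clocally_integrable b.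
Variables (I P Q K : dyadic).
Hypothesis IPQ : is_split I P Q.
Hypothesis KP : K \in descendants i P.

Lemma haar_kernel_lower L : L \in descendants j Q ->
  1 / (c * dlen I) <= normc (haar_kernel i j coef (dleft L) (dleft K)).
Proof.
move=> LQ.
have [KsP eK] := chP (@descendants_ch R _ _ _ KP).
have [LsQ eL] := chP (@descendants_ch R _ _ _ LQ).
have eP := is_split_level IPQ; have eQ := is_split_level (is_split_sym IPQ).
have nc := not_common_half IPQ KsP LsQ.
have := @nondeg I K L; rewrite /kernel_coef asboolF//; apply => //.
  apply: ch_level; last by rewrite eK eP; lia.
  by move=> x /KsP; exact: is_split_sub IPQ _.
apply: ch_level; last by rewrite eL eQ; lia.
by move=> x /LsQ; exact: is_split_sub (is_split_sym IPQ) _.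
Qed.

Lemma cintegrable_mul_cindic : cintegrable (fun y => b y * cindic K y).
Proof.
have [lr li] := lb.
split; apply: (integrable_supported (K := K)).
- apply: eq_integrable (integrable_dset K lr) => // x /[!inE] Kx /=.
  by rewrite cindic_in// mulr1.
- by move=> x /cindic_out ->; rewrite mulr0.
- apply: eq_integrable (integrable_dset K li) => // x /[!inE] Kx /=.
  by rewrite cindic_in// mulr1.
- by move=> x /cindic_out ->; rewrite mulr0.
Qed.

Lemma cintegral_mul_cindic :
  cintegral setT (fun y => b y * cindic K y) = (dlen K)%:C * cmean b K.
Proof.
rewrite (cintegral_supported (K := K)); last first.
  by move=> x /cindic_out ->; rewrite mulr0.
rewrite /cmean mulrA -rmorphM /= mulfV ?gt_eqF ?dlen_gt0// mul1r.
by rewrite /cintegral; congr (_ +i* _); apply: eq_Rintegral => x /[!inE] Kx;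
  rewrite cindic_in// mulr1.
Qed.

Lemma cintegrable_cindic : cintegrable (@cindic R K).
Proof.
by have [_] := bounded_supported (cmeasurable_cindic K) (normc_cindic_le1 K)
  (@cindic_out R K).
Qed.

(* On the other half of [I] the commutator applied to 1_K is
   a^I_{KL} |K| (<b>_K - b). *)
Lemma osc_le_commutator : {ae leb, forall x, dset Q x ->
  normc (b x - cmean b K) <=
    2 ^+ i.+1 * c * normc (mult_commutator T b (cindic K) x)}.
Proof.
apply: (@ae_descendants j) => L LQ.
have low := haar_kernel_lower LQ.
have gK x : ~ dset K x -> b x * cindic K x = 0.
  by move=> /cindic_out ->; rewrite mulr0.
have := haar_shift_separated hT IPQ KP LQ cintegrable_mul_cindic gK.
have := haar_shift_separated hT IPQ KP LQ cintegrable_cindic (@cindic_out R K).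
apply: filterS2 => x h1 h2 Lx; rewrite /mult_commutator h1// h2//.
rewrite cintegral_mul_cindic cintegral_cindic.
set A := haar_kernel _ _ _ _ _ in low *.
have -> : (dlen K)%:C * cmean b K * A - b x * ((dlen K)%:C * A) =
   (dlen K)%:C * A * (cmean b K - b x) by ring.
have K0 := @dlen_gt0 R K; have I0 := @dlen_gt0 R I.
rewrite !normcM normc_real (ger0_norm (ltW K0)) (normcB (cmean b K)).
have [KsP eK] := chP (@descendants_ch R _ _ _ KP).
(* Origin of 2^(i+1): the commutator carries the factor |K| |a|, while the non-degeneracy bounds c
   |I| |a| from below by 1. *)
have eI : dlen I = 2 ^+ i.+1 * dlen K :> R.
  by apply: dlenD; rewrite eK (is_split_level IPQ); lia.
rewrite mulrA -[leLHS]mul1r; apply: ler_wpM2r; first exact: normc_ge0.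
have e1 : 1 = c * dlen I * (1 / (c * dlen I)).
  by rewrite mul1r mulfV// gt_eqF// mulr_gt0.
rewrite [leLHS]e1.
have -> : 2 ^+ i.+1 * c * (dlen K * normc A) = c * dlen I * normc A.
  by rewrite eI; ring.
by apply: ler_wpM2l low; rewrite ltW// mulr_gt0.
Qed.

Lemma cmeasurable_commutator_cindic : cmeasurable (mult_commutator T b (cindic K)).
Proof.
apply: cmeasurableB.
  exact: haar_shift_L1_measurable hT _ cintegrable_mul_cindic.
apply: cmeasurableM; first exact: clocally_integrable_cmeasurable.
exact: haar_shift_L1_measurable hT _ cintegrable_cindic.
Qed.

Lemma integral_osc_le_commutator w (p B : R) : measurable_fun setT w ->
  (forall x, 0 <= w x) -> 0 < p ->
  (\int[leb]_x (normc (mult_commutator T b (cindic K) x) `^ p * w x)%:E <= B%:E)%E ->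
  (\int[leb]_(x in dset Q) (normc (b x - cmean b K) `^ p * w x)%:E <=
   ((2 ^+ i.+1 * c) `^ p * B)%:E)%E.
Proof.
move=> mw w0 p0 hB; set F := fun x => (normc (mult_commutator T b (cindic K) x)
  `^ p * w x)%:E in hB.
have F0 x : (0 <= F x)%E by rewrite lee_fin mulr_ge0// powR_ge0.
have mF D : measurable_fun D F.
  apply/measurable_EFinP/measurable_funTS/measurable_funM => //.
  exact: measurable_normc_powR cmeasurable_commutator_cindic.
set C := (2 ^+ i.+1 * c) `^ p.
apply: (@le_trans _ _ (\int[leb]_(x in dset Q) (C%:E * F x)))%E.
  apply: ae_ge0_le_integral => //.
  - by move=> x _; rewrite lee_fin mulr_ge0// powR_ge0.
  - apply/measurable_EFinP/measurable_funTS/measurable_funM => //.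
    exact: measurable_osc_powR.
  - by move=> x _; rewrite mule_ge0// lee_fin powR_ge0.
  - by apply: measurable_funeM; exact: mF.
  have := osc_le_commutator; apply: filterS => x h Qx.
  rewrite -EFinM lee_fin mulrA ler_wpM2r// -powRM ?normc_ge0//; last first.
    by rewrite mulr_ge0 ?exprn_ge0// ltW.
  apply: ge0_ler_powR; rewrite ?nnegrE ?normc_ge0 ?(ltW p0)//; last exact: h.
  by rewrite !mulr_ge0 ?normc_ge0 ?exprn_ge0// ltW.
rewrite ge0_integralZl_EFin ?powR_ge0//; last exact: mF.
rewrite EFinM; apply: lee_wpmul2l; first by rewrite lee_fin powR_ge0.
by apply: le_trans hB; apply: ge0_subset_integral => //; exact: mF.
Qed.

End Kernel.

(** * Weights and masses of dyadic intervals *)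

Section Weight.
Variable (w : R -> R).
Hypothesis ww : is_weight w.

(** A weight is positive only almost everywhere, whereas the integral estimates above assume
    pointwise nonnegativity; this representative has it and gives the same integrals. *)
Definition pos_part (x : R) : R := Num.max (w x) 0.

Lemma pos_part_ge0 x : 0 <= pos_part x.
Proof. by rewrite le_max lexx orbT. Qed.

Lemma measurable_weight : measurable_fun setT w.
Proof. by have [[]] := ww. Qed.

Lemma measurable_pos_part : measurable_fun setT pos_part.
Proof. exact: measurable_maxr measurable_weight (measurable_cst _). Qed.

Lemma locally_integrable_pos_part : locally_integrable setT pos_part.
Proof.
have [[mw oT wfin] _] := ww; split=> // [|D DT cD]; first exact: measurable_pos_part.
apply: le_lt_trans (wfin D DT cD); apply: ge0_le_integral => //.
- exact: compact_measurable.
- by apply/measurable_EFinP/measurableT_comp => //;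
    apply: measurable_funTS; exact: measurable_pos_part.
- by apply/measurable_EFinP/measurableT_comp => //; exact: measurable_funTS.
- move=> x _; rewrite lee_fin /pos_part; have [w0|w0] := leP (w x) 0.
    by rewrite normr0.
  by [].
Qed.

Lemma integral_pos_part (h : R -> R) D : measurable D -> measurable_fun setT h ->
  (\int[leb]_(x in D) (h x * w x)%:E = \int[leb]_(x in D) (h x * pos_part x)%:E)%E.
Proof.
move=> mD mh; apply: ae_eq_integral => //.
- apply/measurable_EFinP/measurable_funTS/measurable_funM => //.
  exact: measurable_weight.
- apply/measurable_EFinP/measurable_funTS/measurable_funM => //.
  exact: measurable_pos_part.
- have [_] := ww; apply: filterS => x w0 _ /=.
  by rewrite /pos_part max_l// ltW.
Qed.

Definition mass (J : dyadic) : R := \int[leb]_(x in dset J) pos_part x.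

Lemma massE J : (\int[leb]_(x in dset J) (pos_part x)%:E = (mass J)%:E)%E.
Proof.
rewrite /mass /Rintegral fineK//.
apply: integrable_fin_num => //.
exact: integrable_dset locally_integrable_pos_part.
Qed.

Lemma wmassE J : wmass w J = (mass J)%:E.
Proof.
rewrite -massE /wmass; have := @integral_pos_part (cst 1) _ (measurable_dset J)
  (measurable_cst _).
by under eq_integral do rewrite mul1r; under [in X in _ = X -> _]eq_integral do rewrite mul1r.
Qed.

Lemma mass_halves J : mass J = mass (lhalf J) + mass (rhalf J).
Proof. exact: Rintegral_split (lhalf_split J) locally_integrable_pos_part. Qed.

(** If the mass were 0, the weight would be nonpositive almost everywhere on J, so J would be a null
    set. Positivity makes the division by mu(J) in the theorem a real one. *)
Lemma mass_gt0 J : 0 < mass J.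
Proof.
have m0 : 0 <= mass J by apply: Rintegral_ge0 => x _; exact: pos_part_ge0.
rewrite lt_neqAle m0 andbT; apply/eqP => /esym e.
have mp : measurable_fun (dset J) (fun x => (pos_part x)%:E).
  by apply/measurable_EFinP/measurable_funTS; exact: measurable_pos_part.
have X0 : (\int[leb]_(x in dset J) `|(pos_part x)%:E| = 0)%E.
  by under eq_integral do rewrite gee0_abs ?lee_fin ?pos_part_ge0//; rewrite massE e.
have z : {ae leb, forall x, dset J x -> (pos_part x)%:E = 0%E}.
  exact: (iffLR (ae_eq_integral_abs leb (measurable_dset J) mp) X0).
have : {ae leb, forall x, ~ dset J x}.
  have [_] := ww; move: z; apply: filterS2 => x z w0 /z [].
  by rewrite /pos_part max_l ?ltW// => wx; move: w0; rewrite wx ltxx.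
move=> [N [mN N0 sN]].
have : (leb (dset J) <= leb N)%E.
  apply: le_measure; rewrite ?inE//.
  by move=> x Jx; apply: sN => /= h; exact: h.
rewrite N0 lebesgue_dset lee_fin leNgt => /negP; apply; exact: dlen_gt0.
Qed.

End Weight.

Lemma wLpnorm_cindic (p : R) w K : is_weight w -> p != 0 ->
  wLpnorm p w (cindic K) = (mass w K `^ p^-1)%:E.
Proof.
move=> ww p0; rewrite /wLpnorm -poweR_EFin -wmassE//; congr (_ `^ _)%E.
rewrite /wmass [RHS]integral_mkcond; apply: eq_integral => x _.
rewrite patchE; case: ifPn => [|/negP]; rewrite inE.
  by move=> Kx; rewrite cindic_in// normc1 powR1 mul1r.
by move=> Kx; rewrite cindic_out// normc0 powR0// mul0r.
Qed.

Lemma bounded_compactly_supported_cindic K : bounded_compactly_supported (@cindic R K).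
Proof.
split; first exact: cmeasurable_cindic.
  by exists 1 => x; exact: normc_cindic_le1.
exists `[dleft K, dleft K + dlen K]%classic; split; first exact: segment_compact.
move=> x nx; apply: cindic_out => /dsetE /andP[h1 /ltW h2]; apply: nx.
by rewrite /= in_itv /= h1.
Qed.

Lemma oscillation_le_commutator_bound (p : R) i j coef T (c : R) mu lambda b (M : R) J :
  1 < p -> is_haar_shift i j coef T -> 0 < c -> nondegenerate_kernel i j coef c ->
  is_weight mu -> is_weight lambda -> clocally_integrable b -> 0 <= M ->
  (forall f, bounded_compactly_supported f ->
    (wLpnorm p lambda (mult_commutator T b f) <= M%:E * wLpnorm p mu f)%E) ->
  (\int[leb]_(x in dset J) (normc (b x - cmean b J) `^ p * lambda x)%:E <=
   (2 ^- i * ((2 ^+ i.+1 * c) `^ p * M `^ p) * mass mu J)%:E)%E.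
Proof.
move=> p1 hT c0 nondeg wmu wla lb M0 hM.
have p0 : 0 < p by rewrite (lt_trans ltr01).
have pn0 : p != 0 by rewrite gt_eqF.
have mla := measurable_pos_part wla; have la0 := @pos_part_ge0 lambda.
rewrite integral_pos_part//; last exact: measurable_osc_powR.
apply: (integral_osc_le lb mla la0 (ltW p1) (mass_halves wmu)); last 2 first.
- by rewrite !mulr_ge0 ?invr_ge0 ?exprn_ge0 ?powR_ge0.
- by move=> J'; rewrite ltW// mass_gt0.
(* The estimate for each K in ch_i(P) has constant (2^(i+1) c)^p M^p; the averaging over these K
   supplies the 2^(-i). *)
move=> I P Q s; apply: (integral_osc_descendants lb mla la0 (ltW p1) (mass_halves wmu)) => //.
move=> K KP; rewrite -mulrA.
apply: (integral_osc_le_commutator hT c0 nondeg lb s KP mla la0 p0).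
have := hM _ (bounded_compactly_supported_cindic K).
rewrite wLpnorm_cindic// /wLpnorm integral_pos_part//; last first.
  exact: measurable_normc_powR (cmeasurable_commutator_cindic hT lb K).
set X := (\int[_]_x _)%E => h.
have X0 : (0 <= X)%E.
  by apply: integral_ge0 => x _; rewrite lee_fin mulr_ge0// powR_ge0.
have m0 : 0 <= mass mu K by rewrite ltW// mass_gt0.
(* The norm inequality for 1_K, where the norm of 1_K in L^p(mu) is mu(K)^(1/p), is raised to the
   power p. *)
rewrite -(poweRe1 X0) -(mulVf pn0) poweRrM.
have -> : (M `^ p * mass mu K)%:E = ((M%:E * (mass mu K `^ p^-1)%:E) `^ p)%E.
  by rewrite -EFinM poweR_EFin powRM ?powR_ge0// -powRrM mulVf// powRr1.
apply: gt0_ler_poweR => //; first exact: ltW.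
  by rewrite in_itv /= leey andbT poweR_ge0.
by rewrite in_itv /= leey andbT -EFinM lee_fin mulr_ge0// powR_ge0.
Qed.

End Commutator.

(** * The constant and the conclusion *)

Lemma powR_constant (R : realType) (p p' c M : R) (i : nat) : p != 0 ->
  p^-1 + p'^-1 = 1 -> 0 <= c -> 0 <= M ->
  (2 ^- i * ((2 ^+ i.+1 * c) `^ p * M `^ p)) `^ p^-1 =
  c * 2 `^ p^-1 * 2 `^ (i.+1%:R / p') * M.
Proof.
move=> p0 hp' c0 M0.
rewrite !powRM ?mulr_ge0 ?powR_ge0 ?invr_ge0 ?exprn_ge0//.
rewrite -!powRrM mulfV// !powRr1 ?exprn_ge0//.
rewrite -powR_invn// -powR_mulrn// -powRrM.
have two0 : (2 : R) != 0 by rewrite pnatr_eq0.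
(* Exponents of 2: since 1/p' = 1 - 1/p, one has -i/p + (i + 1) = 1/p + (i + 1)/p'. *)
have e : 2 `^ (- i%:R * p^-1) * 2 `^ i.+1%:R =
    2 `^ p^-1 * 2 `^ (i.+1%:R / p') :> R.
  rewrite -!powRD ?two0 ?implybT//; congr (_ `^ _).
  have -> : p'^-1 = 1 - p^-1 by rewrite -hp' addrC addKr.
  by rewrite -natr1; ring.
by rewrite !mulrA e; ring.
Qed.

Theorem mainTheorem5 (R : realType) (p p' : R) (hp : 1 < p)
    (hp' : p^-1 + p'^-1 = 1) :
  exists cp : R, 0 < cp /\
  forall (i j : nat) (coef : dyadic -> dyadic -> dyadic -> R[i])
    (T : (R -> R[i]) -> (R -> R[i])) (c : R) (mu lambda : R -> R)
    (b : R -> R[i]),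
  is_haar_shift i j coef T ->
  0 < c -> nondegenerate_kernel i j coef c ->
  dyadic_Ap p mu -> dyadic_Ap p lambda ->
  clocally_integrable b ->
  forall J : dyadic,
  (((wmass mu J)^-1 *
     \int[lebesgue_measure]_(x in dset J)
        (normc (b x - cmean b J) `^ p * lambda x)%:E) `^ p^-1
   <= (c * cp * 2 `^ (i.+1%:R / p'))%:E * commutator_norm p mu lambda T b)%E.
Proof.
have p0 : 0 < p by rewrite (lt_trans ltr01).
have pn0 : p != 0 by rewrite gt_eqF.
exists (2 `^ p^-1); split; first exact: powR_gt0.
move=> i j coef T c mu lambda b hT c0 nondeg [wmu _] [wla _] lb J.
have C0 : 0 < c * 2 `^ p^-1 * 2 `^ (i.+1%:R / p') by rewrite !mulr_gt0 ?powR_gt0.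
(* Dividing by the positive constant leaves a lower bound for an infimum, to be checked for each
   admissible M; an unbounded commutator has no such M, so this case is covered. *)
rewrite -lee_pdivrMl//; apply/ereal_infP => _ [M [M0 hM] <-].
rewrite lee_pdivrMl// -EFinM -(powR_constant i pn0 hp' (ltW c0) M0).
have X := oscillation_le_commutator_bound J hp hT c0 nondeg wmu wla lb M0 hM.
have m0 := mass_gt0 wmu J.
rewrite (wmassE wmu) inver gt_eqF// -poweR_EFin.
have Y0 : (0 <= \int[lebesgue_measure]_(x in dset J)
    (normc (b x - cmean b J) `^ p * lambda x)%:E)%E.
  rewrite (integral_pos_part wla)//; last exact: measurable_osc_powR.
  by apply: integral_ge0 => x _; rewrite lee_fin mulr_ge0 ?powR_ge0 ?pos_part_ge0.
have mV0 : (0 <= ((mass mu J)^-1)%:E)%E by rewrite lee_fin invr_ge0 ltW.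
apply: gt0_ler_poweR.
- by rewrite invr_ge0 ltW.
- by rewrite in_itv /= leey andbT mule_ge0.
- rewrite in_itv /= leey andbT lee_fin.
  by rewrite !mulr_ge0 ?powR_ge0 ?invr_ge0 ?exprn_ge0.
- by rewrite lee_pdivrMl// muleC.
Qed.
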